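(* Let $p>0$, $0<\alpha<p$, $0<\ell\le\infty$, and let $f$ be a measurable, non-negative, non-increasing function on $(0,\ell)$. (a) If $p\ge1$, then $$\int_0^\ell\Big(\int_0^x f(y)dy\Big)^p x^{-\alpha}\frac{dx}{x}\ge\frac p\alpha\int_0^\ell (xf(x))^p x^{-\alpha}\Big(1-\Big(\frac x\ell\Big)^\alpha\Big)\frac{dx}{x}.$$ (b) If $0<p\le1$, this inequality holds in the reversed direction. (c) The constant $p/\alpha$ is sharp in both (a) and (b); equality holds for every function $f=A\chi_{(0,c)}$ with $c\in(0,\ell)$ and $A>0$.
   Context: When $\ell=\infty$, $(x/\ell)^\alpha$ is interpreted as $0$. $\chi_E$ denotes the indicator function of $E$. *)

(* Defs.v *)
From HB Require Import structures.
From mathcomp Require Import all_boot all_order all_algebra.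
From mathcomp Require Import all_classical all_reals all_analysis.
Set Implicit Arguments. Unset Strict Implicit. Unset Printing Implicit Defensive.
Import Order.TTheory GRing.Theory Num.Theory.
Import numFieldNormedType.Exports.
Local Open Scope classical_set_scope.
Local Open Scope ring_scope.

Section Hardy.
Variable R : realType.

Definition Iol (l : \bar R) : set R := [set x : R | 0 < x /\ (x%:E < l)%E].

(* (x / l)^a, interpreted as 0 when l = +oo *)
Definition ratio_pow (x : R) (l : \bar R) (a : R) : R :=
  match l with
  | r%:E => (x / r) `^ a
  | _ => 0
  end.

Definition admissible (l : \bar R) (f : R -> R) : Prop :=
  [/\ measurable_fun (Iol l) f,
      (forall x, Iol l x -> 0 <= f x) &
      (forall x y, Iol l x -> Iol l y -> x <= y -> f y <= f x)].

Definition primitive (f : R -> R) (x : R) : \bar R :=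
  let I := `]0, x[%classic in
  (\int[@lebesgue_measure R]_(y in I) (f y)%:E)%E.

Definition hardy_lhs (p a : R) (l : \bar R) (f : R -> R) : \bar R :=
  (\int[@lebesgue_measure R]_(x in Iol l)
     (poweR (primitive f x) p * ((x `^ (- a)) / x)%:E))%E.

Definition hardy_rhs_int (p a : R) (l : \bar R) (f : R -> R) : \bar R :=
  (\int[@lebesgue_measure R]_(x in Iol l)
     (((x * f x) `^ p * x `^ (- a) * (1 - ratio_pow x l a) / x)%:E))%E.

End Hardy.

(* Main.v *)
(* Write F for the primitive of f and w(x) = x^-a - l^-a for the weight.
   Since f is non-increasing, F(x) >= x f(x), and the monotonicity of
   S |-> (S + d)^p - S^p bounds F(qx)^p - F(x)^p, for q > 1, from below by
   f(qx)^p ((qx)^p - x^p) when p >= 1 and from above by f(x)^p ((qx)^p - x^p)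
   when p <= 1.  Integrating this against w(qx) dx/x, the change of variables
   qx -> x moves the difference onto the weight, and
   w(x) - w(qx) = (1 - q^-a) x^-a.  With I and J the two integrals of the
   theorem this yields (1 - q^-p) J <= (1 - q^-a) I in case (a), and
   (1 - q^-a) I <= (q^p - 1) J up to the end point l in case (b); letting q tend
   to 1 gives the constant p/a.  In (b) the integrals that cancel must be
   finite, so the inequality is first proved for truncations of f on smaller
   intervals.  The functions A chi_(0,c) are computed explicitly, and their
   integrals are finite and positive, whence the sharpness. *)
Require Import Defs.
From HB Require Import structures.
From mathcomp Require Import all_boot all_order all_algebra.
From mathcomp Require Import all_classical all_reals all_analysis.
From mathcomp Require Import measurable_realfun.
From mathcomp Require Import ring lra.
Set Implicit Arguments.
Unset Strict Implicit.
Unset Printing Implicit Defensive.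
Import Order.TTheory GRing.Theory Num.Theory.
Import numFieldNormedType.Exports.
Local Open Scope classical_set_scope.
Local Open Scope ring_scope.

(** * Convexity, concavity and increments of powers *)

Section powR_increments.
Context {R : realType}.
Implicit Types p s d t x y : R.

Lemma powR_convex p t x y : 1 <= p -> 0 <= t <= 1 -> 0 <= x -> 0 <= y ->
  (t * x + (1 - t) * y) `^ p <= t * x `^ p + (1 - t) * y `^ p.
Proof.
move=> p1 /andP[t0 t1] x0 y0.
have := @convex_powR R p p1 (Itv01 t0 t1) x y.
by rewrite !convRE !inE /= !in_itv /= !andbT; exact.
Qed.

(** Since 1/p >= 1, convexity of the power 1/p applies at the points x^p and y^p; raising the result
    to the power p gives concavity. *)
Lemma powR_concave p t x y : 0 < p -> p <= 1 -> 0 <= t <= 1 ->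
  0 <= x -> 0 <= y ->
  t * x `^ p + (1 - t) * y `^ p <= (t * x + (1 - t) * y) `^ p.
Proof.
move=> p0 p1 t01 x0 y0; have /andP[t0 t1] := t01.
have V1 : 1 <= p^-1 by rewrite -invr1 lef_pV2 ?posrE.
have pV z : 0 <= z -> (z `^ p) `^ p^-1 = z.
  by move=> z0; rewrite -powRrM mulfV ?gt_eqF// powRr1.
have := powR_convex V1 t01 (powR_ge0 x p) (powR_ge0 y p).
rewrite !pV// => /(ge0_ler_powR (ltW p0)).
rewrite -powRrM mulVf ?gt_eqF// powRr1; last first.
  by rewrite addr_ge0// mulr_ge0 ?powR_ge0// subr_ge0.
apply; rewrite ?nnegrE ?powR_ge0//.
by rewrite addr_ge0// mulr_ge0 ?subr_ge0.
Qed.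

(** The inner points s + d and S are convex combinations of the outer points s and S + d with
    exchanged weights. When the two Jensen inequalities are added, the weights sum to 1 and t
    disappears. *)
Let weights {s S d} : 0 <= d -> s <= S -> s < S + d ->
  let t := d / (S + d - s) in
  [/\ 0 <= t <= 1, s + d = t * (S + d) + (1 - t) * s &
      S = t * s + (1 - t) * (S + d)].
Proof.
move=> d0 sS sSd /=; set b := S + d - s.
have b0 : 0 < b by rewrite subr_gt0.
split; last 2 first.
- by rewrite /b; field; rewrite gt_eqF.
- by rewrite /b; field; rewrite gt_eqF.
- by rewrite divr_ge0 ?(ltW b0)//= ler_pdivrMr// mul1r /b; lra.
Qed.

Lemma powR_increment_ndecr p s S d : 1 <= p -> 0 <= s -> s <= S -> 0 <= d ->
  S `^ p + (s + d) `^ p <= (S + d) `^ p + s `^ p.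
Proof.
move=> p1 s0 sS d0.
(* If the outer points coincide, the weights would divide by 0; then d = 0 and S = s, and both sides
   agree. *)
have [sSd|sSd] := ltP s (S + d); last first.
  have -> : d = 0 by lra.
  have -> : S = s by lra.
  by rewrite !addr0.
have [t01 e1 e2] := weights d0 sS sSd; move: t01 e1 e2.
set t := _ / _ => t01 e1 e2.
have Sd0 : 0 <= S + d by lra.
have := powR_convex p1 t01 Sd0 s0; rewrite -e1 => h1.
have := powR_convex p1 t01 s0 Sd0; rewrite -e2 => h2.
lra.
Qed.

Lemma powR_increment_nincr p s S d : 0 < p -> p <= 1 -> 0 <= s -> s <= S ->
  0 <= d -> (S + d) `^ p + s `^ p <= S `^ p + (s + d) `^ p.
Proof.
move=> p0 p1 s0 sS d0.
have [sSd|sSd] := ltP s (S + d); last first.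
  have -> : d = 0 by lra.
  have -> : S = s by lra.
  by rewrite !addr0.
have [t01 e1 e2] := weights d0 sS sSd; move: t01 e1 e2.
set t := _ / _ => t01 e1 e2.
have Sd0 : 0 <= S + d by lra.
have := powR_concave p0 p1 t01 Sd0 s0; rewrite -e1 => h1.
have := powR_concave p0 p1 t01 s0 Sd0; rewrite -e2 => h2.
lra.
Qed.

(* The two integral inequalities at ratio q > 1 vanish at q = 1; comparing
   derivatives there produces the constant p / a. *)
Lemma powR_combination_derive1_ge0 (c1 c2 r1 r2 q0 : R) : 1 < q0 ->
  (forall q, 1 < q < q0 -> 0 <= c1 * (q `^ r1 - 1) + c2 * (q `^ r2 - 1)) ->
  0 <= c1 * r1 + c2 * r2.
Proof.
move=> q01 h.
pose H (q : R) : R := c1 * (q `^ r1 - 1) + c2 * (q `^ r2 - 1).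
have dH : is_derive (1 : R) (1 : R) H (c1 * r1 + c2 * r2).
  have d r : is_derive (1 : R) 1 ((@powR R ^~ r) - cst 1) r.
    have := is_deriveB (@is_derive1_powR R r 1 ltr01)
      (is_derive_cst (1 : R) (1 : R) (1 : R)).
    by rewrite powR1 mulr1 subr0.
  exact: is_deriveD (is_deriveZ c1 (d r1)) (is_deriveZ c2 (d r2)).
have [dH1 dH2] := dH.
have := dH1; rewrite /derivable => /cvg_ex [L HL].
have EL : L = c1 * r1 + c2 * r2.
  by rewrite -dH2 /derive; apply/esym/cvg_lim.
rewrite -EL.
have := @cvg_dnbhs_at_right _ _ _ 0 L HL.
move=> HL'; rewrite -(cvg_lim _ HL')//; apply: limr_ge; first exact: cvgP HL'.
near=> e.
have e0 : 0 < e by near: e; exact: nbhs_right_gt.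
have eq0 : e < q0 - 1.
  by near: e; apply: nbhs_right_lt; lra.
rewrite /= /GRing.scale/= !mulr1.
have -> : H 1 = 0 by rewrite /H !powR1 subrr !mulr0 addr0.
rewrite subr0 mulr_ge0 ?invr_ge0 ?(ltW e0)//; apply: h; lra.
Unshelve. all: by end_near. Qed.

End powR_increments.

(** * Dilations of Lebesgue measure and measurability of monotone functions *)

Section scaling.
Context {R : realType}.
Local Notation mu := (@lebesgue_measure R).
Local Open Scope ereal_scope.

(** Lebesgue measure is q times its pushforward under multiplication by q: the two agree on
    half-open intervals, and uniqueness of the measure extends this to all measurable sets. *)
Lemma ge0_integral_scale (q : R) (D : set R) (g : R -> \bar R) : (0 < q)%R ->
  measurable D -> measurable_fun D g -> (forall x, D x -> 0 <= g x) ->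
  \int[mu]_(x in D) g x = q%:E * \int[mu]_(u in [set u | D (q * u)%R]) g (q * u)%R.
Proof.
move=> q0 mD mg g0.
pose phi : measurableTypeR R -> measurableTypeR R := *%R q.
have mq : measurable_fun setT phi by exact: mulrl_measurable.
pose mphi := pushforward mu phi : {measure set (measurableTypeR R) -> \bar R}.
pose m : {measure set (measurableTypeR R) -> \bar R} :=
  mscale (NngNum (ltW q0)) (mphi mq).
have mE (A : set R) : measurable A -> mu A = m A.
  apply: lebesgue_measure_unique => _ [[a b] _ <-].
  transitivity (q%:E * mu `](a / q)%R, (b / q)%R]%classic).
    rewrite !lebesgue_measure_itv/= !lte_fin ltr_pM2r ?invr_gt0//.
    case: ifPn => _; last by rewrite mule0.
    by rewrite -!EFinB -EFinM; congr (_%:E); field; rewrite gt_eqF.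
  congr (_ * mu _); apply/seteqP; split => x /=;
  by rewrite !in_itv/= ltr_pdivrMr// ler_pdivlMr// /phi (mulrC q).
rewrite (@eq_measure_integral _ (measurableTypeR R) _ D m) => [|A mA _]; last exact: mE.
rewrite /m (@ge0_integral_mscale _ (measurableTypeR R))//=; congr (_ * _).
by rewrite (ge0_integral_pushforward mq)// => x /set_mem; exact: g0.
Qed.

(** The preimage in D of a closed upper ray is an interval, and such rays generate the measurable
    sets of the extended line. *)
Lemma nondecreasing_emeasurable (D : set R) (g : R -> \bar R) :
  measurable D -> is_interval D ->
  {in D &, forall x y, (x <= y)%R -> g x <= g y} -> measurable_fun D g.
Proof.
move=> mD iD g_nd _.
apply: (measurability _ (ErealGenCInfty.measurableE R)) => //= _ [_ [r ->] <-].
apply: is_interval_measurable => s t /= [Ds gs] [Dt gt] u /andP[su ut].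
have Du : D u by apply: (iD s t) => //; rewrite su ut.
split => //; move: gs; rewrite !in_itv/= !andbT => /le_trans; apply.
by rewrite g_nd ?inE.
Qed.

End scaling.

(** * The primitive F of a non-increasing function and the growth of F^p *)

Section primitive_bounds.
Context {R : realType}.
Local Notation mu := (@lebesgue_measure R).
Variables (l : \bar R).
Implicit Types (x z : R).
Local Open Scope ereal_scope.

Lemma is_interval_Iol : is_interval (Iol l).
Proof.
move=> s t [s0 _] [_ tl] u /andP[su ut]; split; first exact: lt_le_trans su.
by rewrite (le_lt_trans _ tl)// lee_fin.
Qed.

Lemma measurable_Iol : measurable (Iol l).
Proof. exact: is_interval_measurable is_interval_Iol. Qed.

Lemma Iol_down z x : (0 < z)%R -> (z <= x)%R -> Iol l x -> Iol l z.
Proof.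
by move=> z0 zx [_ xl]; split => //; rewrite (le_lt_trans _ xl)// lee_fin.
Qed.

Variable (f : R -> R).
Hypothesis adm : admissible l f.

Lemma admissible_measurable_sub (A : set R) : measurable A -> A `<=` Iol l ->
  measurable_fun A (EFin \o f).
Proof.
move=> mA AI; apply/measurable_EFinP; apply: measurable_funS AI _.
  exact: measurable_Iol.
by case: adm.
Qed.

Let sub_oo x : Iol l x -> `]0%R, x[ `<=` Iol l.
Proof.
move=> Ix y /=; rewrite in_itv/= => /andP[y0 yx].
exact: Iol_down (ltW yx) Ix.
Qed.

Let sub_co z x : (0 < z)%R -> Iol l x -> `[z, x[ `<=` Iol l.
Proof.
move=> z0 Ix y /=; rewrite in_itv/= => /andP[zy yx].
exact: Iol_down (lt_le_trans z0 zy) (ltW yx) Ix.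
Qed.

Lemma primitive_ge0 x : Iol l x -> 0 <= primitive f x.
Proof.
move=> Ix; apply: integral_ge0 => y /(sub_oo Ix) Iy; rewrite lee_fin.
by case: adm => _ f0 _; exact: f0.
Qed.

Lemma primitive_split z x : (0 < z)%R -> (z <= x)%R -> Iol l x ->
  primitive f x = primitive f z + \int[mu]_(y in `[z, x[) (f y)%:E.
Proof.
move=> z0 zx Ix; rewrite /primitive.
have E : `]0%R, x[%classic = `]0%R, z[ `|` `[z, x[.
  by apply: itv_bndbnd_setU; rewrite bnd_simp// ltW.
rewrite E ge0_integral_setU -?E//.
- by apply: admissible_measurable_sub => //; exact: sub_oo.
- move=> y /(sub_oo Ix) Iy; rewrite lee_fin.
  by case: adm => _ f0 _; exact: f0.
- apply/disj_setPS => y [] /=; rewrite !in_itv/= => /andP[_ yz] /andP[zy _].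
  by move: (lt_le_trans yz zy); rewrite ltxx.
Qed.

Lemma integral_co_bounds z x : (0 < z)%R -> (z <= x)%R -> Iol l x ->
  (f x * (x - z))%:E <= \int[mu]_(y in `[z, x[) (f y)%:E /\
  \int[mu]_(y in `[z, x[) (f y)%:E <= (f z * (x - z))%:E.
Proof.
move=> z0 zx Ix; have Iz := Iol_down z0 zx Ix.
have [mf f0 fni] := adm.
have muE : mu `[z, x[%classic = (x - z)%:E.
  rewrite lebesgue_measure_itv/= lte_fin; case: ltP => // xz.
  have -> : x = z by apply/eqP; rewrite eq_le xz zx.
  by rewrite subrr.
have mfzx : measurable_fun `[z, x[ (EFin \o f).
  by apply: admissible_measurable_sub => //; exact: sub_co.
by split; rewrite EFinM -muE -integral_cst//; apply: ge0_le_integral => //;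
  [move=> y _; rewrite lee_fin f0
  |move=> y /= yzx; have Iy := sub_co z0 Ix yzx; move: yzx;
   rewrite in_itv/= => /andP[zy yx]; rewrite lee_fin; apply: fni => //;
   rewrite ltW
  |move=> y /(sub_co z0 Ix) Iy; rewrite lee_fin f0
  |move=> y /= yzx; have Iy := sub_co z0 Ix yzx; move: yzx;
   rewrite in_itv/= => /andP[zy yx]; rewrite lee_fin; apply: fni].
Qed.

Lemma primitive_nondecreasing z x : (0 < z)%R -> (z <= x)%R -> Iol l x ->
  primitive f z <= primitive f x.
Proof.
move=> z0 zx Ix; rewrite (primitive_split z0 zx Ix) leeDl// integral_ge0// => y.
by move=> /(sub_co z0 Ix) Iy; rewrite lee_fin; case: adm => _ f0 _; exact: f0.
Qed.

Lemma primitive_ge x : Iol l x -> (x * f x)%:E <= primitive f x.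
Proof.
move=> Ix; have [mf f0 fni] := adm; have [x0 _] := Ix.
have muE : mu `]0%R, x[%classic = x%:E.
  by rewrite lebesgue_measure_itv/= lte_fin x0 -EFinB subr0.
rewrite mulrC EFinM -muE -integral_cst//; apply: ge0_le_integral => //.
- by move=> y _; rewrite lee_fin f0.
- by apply: admissible_measurable_sub => //; exact: sub_oo.
- move=> y /= y0x; have Iy := sub_oo Ix y0x; move: y0x.
  by rewrite in_itv/= => /andP[_ yx]; rewrite lee_fin fni// ltW.
Qed.

Lemma measurable_primitive : measurable_fun (Iol l) (primitive f).
Proof.
apply: nondecreasing_emeasurable; first exact: measurable_Iol.
  exact: is_interval_Iol.
move=> x y /set_mem[x0 _] /set_mem Iy xy; exact: primitive_nondecreasing.
Qed.

Variable p : R.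

(** The increment inequality is used with s = z f(x), S = F(z) and d = f(x) (x - z), so that s + d =
    x f(x). Monotonicity of f gives s <= z f(z) <= S and F(x) >= S + d. *)
Lemma poweR_primitive_increment_ge z x : (1 <= p)%R -> (0 < z)%R -> (z <= x)%R ->
  Iol l x ->
  primitive f z `^ p + (f x `^ p * (x `^ p - z `^ p))%:E <= primitive f x `^ p.
Proof.
move=> p1 z0 zx Ix; have Iz := Iol_down z0 zx Ix.
have p0 : (0 < p)%R by exact: lt_le_trans p1.
(* If F(x) is infinite, so is the right side; otherwise F(z) is finite as well and the claim
   concerns real numbers. *)
have [-> |Fx] := eqVneq (primitive f x) +oo.
  by rewrite poweRyr ?gt_eqF// leey.
have fx0 : (0 <= f x)%R by case: adm => _ f0 _; exact: f0.
have x0 : (0 <= x)%R by case: Ix => /ltW.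
have [int_ge _] := integral_co_bounds z0 zx Ix.
have Fz_ge : (z * f x)%:E <= primitive f z.
  apply: le_trans (primitive_ge Iz); rewrite lee_fin ler_pM2l//.
  by case: adm => _ _; exact.
have Fx_ge : primitive f z + (f x * (x - z))%:E <= primitive f x.
  by rewrite (primitive_split z0 zx Ix) leeD2l.
have Fxf : primitive f x \is a fin_num.
  by rewrite ge0_fin_numE ?primitive_ge0// lt_neqAle Fx leey.
have Fzf : primitive f z \is a fin_num.
  rewrite ge0_fin_numE ?primitive_ge0//.
  by rewrite (le_lt_trans (primitive_nondecreasing z0 zx Ix))// ltey_eq Fxf.
move: Fz_ge Fx_ge; rewrite -(fineK Fxf) -(fineK Fzf) !poweR_EFin -!EFinD !lee_fin.
move: (fine (primitive f x)) (fine (primitive f z)) => r s sge rge.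
have d0 : (0 <= f x * (x - z))%R by rewrite mulr_ge0// subr_ge0.
have v0 : (0 <= z * f x)%R by rewrite mulr_ge0// ltW.
have := powR_increment_ndecr p1 v0 sge d0.
have -> : (z * f x + f x * (x - z) = f x * x)%R by ring.
rewrite (powRM _ fx0 x0) (powRM _ (ltW z0) fx0).
have : ((s + f x * (x - z)) `^ p <= r `^ p)%R.
  have sd0 : (0 <= s + f x * (x - z))%R by rewrite addr_ge0// (le_trans v0).
  by apply: ge0_ler_powR => //; rewrite ?nnegrE ?(ltW p0)//; exact: le_trans rge.
by rewrite mulrBr (mulrC (z `^ p)%R); clear; lra.
Qed.

(** Here f is frozen at the left end: s = z f(z), S = F(z), d = f(z) (x - z), whence s + d = x f(z)
    and F(x) <= S + d. *)
Lemma poweR_primitive_increment_le z x : (0 < p)%R -> (p <= 1)%R -> (0 < z)%R ->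
  (z <= x)%R -> Iol l x ->
  primitive f x `^ p <= primitive f z `^ p + (f z `^ p * (x `^ p - z `^ p))%:E.
Proof.
move=> p0 p1 z0 zx Ix; have Iz := Iol_down z0 zx Ix.
(* Now F(z) decides: if it is infinite the right side is infinite, and if it is finite the upper
   bound makes F(x) finite too. *)
have [-> |Fz] := eqVneq (primitive f z) +oo.
  by rewrite poweRyr ?gt_eqF// addye// leey.
have fz0 : (0 <= f z)%R by case: adm => _ f0 _; exact: f0.
have x0 : (0 <= x)%R by case: Ix => /ltW.
have [_ int_le] := integral_co_bounds z0 zx Ix.
have Fz_ge := primitive_ge Iz.
have Fx_le : primitive f x <= primitive f z + (f z * (x - z))%:E.
  by rewrite (primitive_split z0 zx Ix) leeD2l.
have Fzf : primitive f z \is a fin_num.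
  by rewrite ge0_fin_numE ?primitive_ge0// lt_neqAle Fz leey.
have Fxf : primitive f x \is a fin_num.
  rewrite ge0_fin_numE ?primitive_ge0//.
  by rewrite (le_lt_trans Fx_le)// ltey_eq fin_numD Fzf.
have := primitive_ge0 Ix.
move: Fz_ge Fx_le; rewrite -(fineK Fxf) -(fineK Fzf) !poweR_EFin -!EFinD !lee_fin.
move: (fine (primitive f x)) (fine (primitive f z)) => r s sge rle r0.
have d0 : (0 <= f z * (x - z))%R by rewrite mulr_ge0// subr_ge0.
have v0 : (0 <= z * f z)%R by rewrite mulr_ge0// ltW.
have := powR_increment_nincr p0 p1 v0 sge d0.
have -> : (z * f z + f z * (x - z) = f z * x)%R by ring.
rewrite (powRM _ fz0 x0) (powRM _ (ltW z0) fz0).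
have : (r `^ p <= (s + f z * (x - z)) `^ p)%R.
  by apply: ge0_ler_powR => //; rewrite ?nnegrE ?(ltW p0)//; exact: le_trans rle.
by rewrite mulrBr (mulrC (z `^ p)%R); clear; lra.
Qed.

End primitive_bounds.

(** * The weight w and its behaviour under dilation *)

Section weights.
Context {R : realType}.
Variables (l : \bar R) (a : R).
Hypotheses (l0 : (0 < l)%E) (a0 : 0 < a).

(** This is l^-a. The value 0 at l = +oo agrees with the convention (x/l)^a = 0. *)
Definition endpoint_pow : R := if l is r%:E then r `^ (- a) else 0.

(** For x > 0 this equals x^-a (1 - (x/l)^a). Written as a difference, it shows that the constant
    l^-a cancels when w(x) is compared with w(qx). *)
Definition hardy_weight (x : R) : R := x `^ (- a) - endpoint_pow.

Let l_ge0 r : l = r%:E -> 0 < r.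
Proof. by move=> lr; move: l0; rewrite lr lte_fin. Qed.

Lemma powR_inv (x r : R) : 0 <= x -> x^-1 `^ r = x `^ (- r).
Proof. by move=> x0; rewrite -powR_inv1// -powRrM mulN1r. Qed.

Lemma powRNM (x r : R) : 0 < x -> x `^ (- r) * x `^ r = 1.
Proof. by move=> x0; rewrite powRN mulVf// gt_eqF// powR_gt0. Qed.

Lemma ler_powRN (x y : R) : 0 < x -> x <= y -> y `^ (- a) <= x `^ (- a).
Proof.
move=> x0 xy; have y0 : 0 < y by exact: lt_le_trans xy.
rewrite -(powR_inv a (ltW x0)) -(powR_inv a (ltW y0)).
by rewrite ge0_ler_powR ?nnegrE ?invr_ge0 ?(ltW a0) ?(ltW x0) ?(ltW y0)// lef_pV2.
Qed.

Lemma powRN_le1 (q : R) : 1 <= q -> q `^ (- a) <= 1.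
Proof. by move=> q1; have := ler_powRN ltr01 q1; rewrite powR1. Qed.

Lemma endpoint_pow_ge0 : 0 <= endpoint_pow.
Proof. by rewrite /endpoint_pow; case: l => // r; exact: powR_ge0. Qed.

Lemma hardy_weight_ge0 x : Iol l x -> 0 <= hardy_weight x.
Proof.
rewrite /hardy_weight /endpoint_pow subr_ge0; case: l => [r| |] [x0 xl].
- by apply: ler_powRN => //; move: xl; rewrite lte_fin => /ltW.
- exact: powR_ge0.
- by [].
Qed.

Lemma endpoint_pow_ge x : 0 < x -> (l <= x%:E)%E -> x `^ (- a) <= endpoint_pow.
Proof.
rewrite /endpoint_pow; case: l l0 l_ge0 => [r| |] l1 lr x0 lx.
- by apply: ler_powRN; [exact: lr|move: lx; rewrite lee_fin].
- by move: lx; rewrite leye_eq.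
- by move: l1; rewrite ltNge leNye.
Qed.

Lemma hardy_weight_le x : hardy_weight x <= x `^ (- a).
Proof. by rewrite gerBl endpoint_pow_ge0. Qed.

Lemma powR_ratio_powE x : 0 < x ->
  x `^ (- a) * (1 - ratio_pow x l a) = hardy_weight x.
Proof.
move=> x0; rewrite /hardy_weight /endpoint_pow /ratio_pow.
case: l l_ge0 => [r| |] lr; rewrite ?subr0 ?mulr1//.
have r0 := lr _ erefl.
rewrite powRM ?invr_ge0 ?ltW// powR_inv ?ltW// mulrBr mulr1 mulrA.
by rewrite powRNM// mul1r.
Qed.

Lemma hardy_weight_scale (q x : R) : 0 < q -> 0 < x ->
  hardy_weight x = hardy_weight (q * x) + (1 - q `^ (- a)) * x `^ (- a).
Proof.
by move=> q0 x0; rewrite /hardy_weight powRM ?ltW//; ring.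
Qed.

Lemma hardy_weight_scale_le (q x : R) : 0 < q -> 0 < x -> (l <= (q * x)%:E)%E ->
  hardy_weight x <= (1 - q `^ (- a)) * x `^ (- a).
Proof.
move=> q0 x0 lqx; rewrite (hardy_weight_scale q0)// gerDr.
by rewrite subr_le0 endpoint_pow_ge// mulr_gt0.
Qed.

Lemma hardy_weight_scale_nincr (q x : R) : 1 <= q -> 0 < x ->
  hardy_weight (q * x) <= hardy_weight x.
Proof.
by move=> q1 x0; rewrite lerD2r ler_powRN// ler_peMl// ltW.
Qed.

Lemma measurable_hardy_weight (D : set R) : measurable_fun D hardy_weight.
Proof.
apply: measurable_funB => //.
exact: measurable_funS (measurable_powR _).
Qed.

End weights.

(** * The integral inequalities at a fixed ratio q > 1 *)

Section scaled_inequalities.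
Context {R : realType}.
Local Notation mu := (@lebesgue_measure R).
Variables (l : \bar R) (a p : R) (f : R -> R).
Hypotheses (l0 : (0 < l)%E) (a0 : 0 < a) (p0 : 0 < p) (adm : admissible l f).
Local Open Scope ereal_scope.
Local Notation w := (hardy_weight l a).
Local Notation Fp := (fun x => primitive f x `^ p).

Lemma measurable_mulEFin (D : set R) (h : R -> \bar R) (k : R -> R) :
  measurable_fun D h -> measurable_fun D k ->
  measurable_fun D (fun x => h x * (k x)%:E).
Proof. by move=> mh mk; apply: emeasurable_funM => //; exact/measurable_EFinP. Qed.

Lemma measurable_powRS (D : set R) (r : R) : measurable_fun D (@powR R ^~ r).
Proof. exact: measurable_funS (measurable_powR _). Qed.

Lemma measurable_weighted (D : set R) (h : R -> \bar R) (k : R -> R) :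
  measurable_fun D h -> measurable_fun D k ->
  measurable_fun D (fun x => h x * (k x)%:E * (x `^ -1)%:E).
Proof.
move=> mh mk; apply: measurable_mulEFin; last exact: measurable_powRS.
exact: measurable_mulEFin.
Qed.

Lemma measurable_poweR_primitive : measurable_fun (Iol l) Fp.
Proof.
apply: (measurableT_comp (measurable_poweR p)).
exact: measurable_primitive adm.
Qed.

Let h (x : R) : R := ((x * f x) `^ p * w x)%R.

Let h_ge0 x : Iol l x -> (0 <= h x)%R.
Proof. by move=> Ix; rewrite mulr_ge0 ?powR_ge0// hardy_weight_ge0. Qed.

Let mh : measurable_fun (Iol l) h.
Proof.
apply: measurable_funM; last exact: measurable_hardy_weight.
apply: (measurableT_comp (measurable_powR p)).
by apply: measurable_funM => //; case: adm.
Qed.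

(** The factor 1/x is split off so that the integral is taken against dx/x, which is invariant under
    dilations. *)
Lemma hardy_lhsE : hardy_lhs p a l f =
  \int[mu]_(x in Iol l) (Fp x * (x `^ (- a))%:E * (x `^ -1)%:E).
Proof.
apply: eq_integral => x /set_mem[x0 _].
by rewrite (powR_inv1 (ltW x0)) -muleA -EFinM.
Qed.

Lemma hardy_rhs_intE : hardy_rhs_int p a l f =
  \int[mu]_(x in Iol l) ((h x)%:E * (x `^ -1)%:E).
Proof.
apply: eq_integral => x /set_mem[x0 _].
by rewrite (powR_inv1 (ltW x0)) -EFinM /h -(powR_ratio_powE a l0 x0) !mulrA.
Qed.

Lemma hardy_rhs_int_ge0 : 0 <= hardy_rhs_int p a l f.
Proof.
rewrite hardy_rhs_intE; apply: integral_ge0 => x Ix.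
by rewrite -EFinM lee_fin mulr_ge0 ?powR_ge0// h_ge0.
Qed.

Lemma hardy_lhs_ge0 : 0 <= hardy_lhs p a l f.
Proof.
rewrite hardy_lhsE; apply: integral_ge0 => x Ix.
by rewrite !mule_ge0 ?poweR_ge0// lee_fin powR_ge0.
Qed.

Variable (q : R).
Hypothesis q1 : (1 < q)%R.
Let q0 : (0 < q)%R. Proof. exact: lt_trans q1. Qed.

(** This is (0, l/q), written as a preimage so that l = +oo needs no separate case. *)
Definition Iol_scaled : set R := [set u | Iol l (q * u)%R].
Local Notation D := Iol_scaled.

Lemma Iol_scaled_gt0 u : D u -> (0 < u)%R.
Proof. by move=> [+ _]; rewrite pmulr_rgt0. Qed.

Lemma Iol_scaled_sub : D `<=` Iol l.
Proof.
move=> u Du; have u0 := Iol_scaled_gt0 Du.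
by apply: Iol_down Du => //; rewrite ler_peMl// ltW.
Qed.

Lemma measurable_Iol_scaled : measurable D.
Proof.
rewrite /Iol_scaled -[X in measurable X]setTI.
by apply: (@mulrl_measurable R setT q) => //; exact: measurable_Iol.
Qed.
Let mD := measurable_Iol_scaled.

Lemma measurable_scaled d (T : measurableType d) (g : R -> T) :
  measurable_fun (Iol l) g -> measurable_fun D (fun u => g (q * u)%R).
Proof.
move=> mg; apply: (measurable_comp _ _ mg (mulrl_measurable q)).
  exact: measurable_Iol.
by move=> _ [u Du <-].
Qed.

(** The factor q from the change of variables cancels against the q^-1 contained in (qu)^-1. *)
Lemma ge0_integral_haar_scale (g : R -> \bar R) :
  measurable_fun (Iol l) g -> (forall x, Iol l x -> 0 <= g x) ->
  \int[mu]_(x in Iol l) (g x * (x `^ -1)%:E) =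
  \int[mu]_(u in D) (g (q * u)%R * (u `^ -1)%:E).
Proof.
move=> mg g0; have mI := measurable_Iol l.
rewrite (ge0_integral_scale q0)//.
- rewrite -/Iol_scaled -ge0_integralZl_EFin ?ltW//.
  + apply: eq_integral => u /set_mem Du; have u0 := Iol_scaled_gt0 Du.
    rewrite muleCA -EFinM (powRM _ (ltW q0) (ltW u0)).
    rewrite (powR_inv1 (ltW q0)) (powR_inv1 (ltW u0)).
    by rewrite mulrA mulfV ?mul1r// gt_eqF.
  + by move=> u Du; rewrite mule_ge0 ?lee_fin ?powR_ge0// g0.
  + apply: (@measurable_scaled _ _ (fun x => g x * (x `^ -1)%:E)).
    by apply: measurable_mulEFin => //; exact: measurable_powRS.
- by apply: measurable_mulEFin => //; exact: measurable_powRS.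
- by move=> u Iu; rewrite mule_ge0 ?lee_fin ?powR_ge0// g0.
Qed.

(** [A] pairs F with the weight at the same point, [B] pairs F(u) with the weight at qu. The growth
    of F compares [A] with [B] up to a multiple of J; the scaling of w compares them up to a
    multiple of I. *)
Let A := \int[mu]_(x in Iol l) (Fp x * (w x)%:E * (x `^ -1)%:E).
Let B := \int[mu]_(u in D) (Fp u * (w (q * u)%R)%:E * (u `^ -1)%:E).

Let mFp := measurable_poweR_primitive.

Let mFpD : measurable_fun D Fp.
Proof.
by apply: measurable_funS mFp; [exact: measurable_Iol|exact: Iol_scaled_sub].
Qed.

Let mwq : measurable_fun D (fun u => w (q * u)%R).
Proof. by apply: (@measurable_scaled _ _ w); exact: measurable_hardy_weight. Qed.

Let mFpqw : measurable_fun D (fun u => Fp (q * u)%R * (w (q * u)%R)%:E).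
Proof.
apply: (@measurable_scaled _ _ (fun x => Fp x * (w x)%:E)).
by apply: measurable_mulEFin => //; exact: measurable_hardy_weight.
Qed.

Lemma weighted_integral_scale :
  A = \int[mu]_(u in D) (Fp (q * u)%R * (w (q * u)%R)%:E * (u `^ -1)%:E).
Proof.
apply: (@ge0_integral_haar_scale (fun x => Fp x * (w x)%:E)).
  by apply: measurable_mulEFin => //; exact: measurable_hardy_weight.
by move=> x Ix; rewrite mule_ge0 ?poweR_ge0// lee_fin hardy_weight_ge0.
Qed.

Let wq_ge0 u : D u -> (0 <= w (q * u))%R.
Proof. by move=> Du; rewrite hardy_weight_ge0. Qed.

Let term_ge0 (g : \bar R) (k u : R) : 0 <= g -> (0 <= k)%R ->
  0 <= g * k%:E * (u `^ -1)%:E.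
Proof. by move=> g0 k0; rewrite !mule_ge0// lee_fin powR_ge0. Qed.

(** This makes [B] finite as soon as I is, so that [B] can be cancelled. It rests on w(qu) <= w(u)
    <= u^-a. *)
Lemma scaled_integral_le_lhs : B <= hardy_lhs p a l f.
Proof.
rewrite hardy_lhsE.
apply: (@le_trans _ _ (\int[mu]_(x in D) (Fp x * (x `^ (- a))%:E * (x `^ -1)%:E))).
  apply: ge0_le_integral => //.
  - by move=> u Du; rewrite term_ge0 ?poweR_ge0// wq_ge0.
  - by apply: measurable_weighted => //; exact: measurable_powRS.
  - by apply: measurable_weighted => //; exact: measurable_powRS.
  - move=> u Du; rewrite lee_wpmul2r ?lee_fin ?powR_ge0//.
    rewrite lee_wpmul2l ?poweR_ge0// lee_fin.
    have u0 := Iol_scaled_gt0 Du.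
    apply: le_trans (hardy_weight_le l a u).
    exact: (hardy_weight_scale_nincr _ a0 (ltW q1) u0).
apply: ge0_subset_integral => //; first exact: measurable_Iol.
- by apply: measurable_weighted => //; exact: measurable_powRS.
- by move=> u Iu; rewrite term_ge0 ?poweR_ge0// powR_ge0.
- exact: Iol_scaled_sub.
Qed.

(** After dilation [A] contains F(qu)^p w(qu). The increment of F^p is at least f(qu)^p ((qu)^p -
    u^p) = (1 - q^-p) (qu f(qu))^p, and a dilation back turns the integral of this term into J. *)
Let increment_ge : (1 <= p)%R ->
  B + (1 - q `^ (- p))%:E * hardy_rhs_int p a l f <= A.
Proof.
move=> p1.
have qp : (0 <= 1 - q `^ (- p))%R.
  by rewrite subr_ge0 powRN_le1// ltW.
rewrite hardy_rhs_intE (@ge0_integral_haar_scale (EFin \o h)); last 2 first.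
  exact/measurable_EFinP.
  by move=> x Ix; rewrite lee_fin h_ge0.
have mhq : measurable_fun D (fun u => (h (q * u))%:E * (u `^ -1)%:E).
  apply: measurable_mulEFin; last exact: measurable_powRS.
  by apply/measurable_EFinP; exact: (@measurable_scaled _ _ h).
have hq0 u : D u -> 0 <= (h (q * u))%:E * (u `^ -1)%:E.
  by move=> Du; rewrite -EFinM lee_fin mulr_ge0 ?powR_ge0// h_ge0.
rewrite -ge0_integralZl_EFin// -ge0_integralD//.
- rewrite weighted_integral_scale; apply: ge0_le_integral => //.
  + move=> u Du; rewrite adde_ge0//; first by rewrite term_ge0 ?poweR_ge0// wq_ge0.
    by rewrite mule_ge0 ?lee_fin//; exact: hq0.
  + apply: emeasurable_funD.
      by apply: measurable_weighted => //; exact: measurable_powRS.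
    by apply: emeasurable_funM.
  + by apply: measurable_mulEFin => //; exact: measurable_powRS.
  + move=> u Du; have u0 := Iol_scaled_gt0 Du.
    have uqu : (u <= q * u)%R by rewrite ler_peMl// ltW.
    rewrite muleA -ge0_muleDl ?lee_fin ?powR_ge0//; last 2 first.
      by rewrite mule_ge0 ?poweR_ge0// lee_fin wq_ge0.
      by rewrite mulr_ge0// h_ge0.
    rewrite lee_wpmul2r ?lee_fin ?powR_ge0//.
    have fq0 : (0 <= f (q * u))%R by case: adm => _ f0 _; exact: f0.
    have -> : (1 - q `^ (- p))%:E * (h (q * u))%:E =
        (f (q * u) `^ p * ((q * u) `^ p - u `^ p))%:E * (w (q * u))%:E.
      rewrite -!EFinM /h; congr (_%:E); rewrite mulrA; congr (_ * _)%R.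
      rewrite !(powRM p) ?mulr_ge0 ?(ltW q0) ?(ltW u0)//.
      transitivity (f (q * u) `^ p *
          (q `^ p * u `^ p - q `^ (- p) * q `^ p * u `^ p))%R; first by ring.
      by rewrite powRNM// mul1r.
    rewrite -ge0_muleDl ?poweR_ge0 ?lee_fin//; last first.
      rewrite mulr_ge0 ?powR_ge0// subr_ge0.
      by rewrite ge0_ler_powR ?nnegrE ?mulr_ge0 ?(ltW p0) ?(ltW q0) ?(ltW u0).
    rewrite lee_wpmul2r ?lee_fin ?wq_ge0//.
    exact: (poweR_primitive_increment_ge adm p1 u0 uqu Du).
- by move=> u Du; rewrite term_ge0 ?poweR_ge0// wq_ge0.
- by apply: measurable_weighted => //; exact: measurable_powRS.
- by move=> u Du; rewrite mule_ge0 ?lee_fin//; exact: hq0.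
- by apply: emeasurable_funM.
Qed.

(** The integrand of [B] is extended by 0 to (0,l). Below l/q the scaling identity of w is exact;
    from l/q on, w(qx) <= 0 gives the inequality. *)
Let weight_le : A <= B + (1 - q `^ (- a))%:E * hardy_lhs p a l f.
Proof.
have mI := measurable_Iol l.
have qa : (0 <= 1 - q `^ (- a))%R.
  by rewrite subr_ge0 powRN_le1// ltW.
have mB : measurable_fun (Iol l)
    ((fun u => Fp u * (w (q * u)%R)%:E * (u `^ -1)%:E) \_ D).
  apply/(measurable_restrict _ mD mI).
  rewrite (_ : _ `&` _ = D); last by apply: setIidr; exact: Iol_scaled_sub.
  by apply: measurable_weighted => //; exact: measurable_powRS.
have mI1 : measurable_fun (Iol l) (fun x => Fp x * (x `^ (- a))%:E * (x `^ -1)%:E).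
  by apply: measurable_weighted => //; exact: measurable_powRS.
have I1_0 x : Iol l x -> 0 <= Fp x * (x `^ (- a))%:E * (x `^ -1)%:E.
  by move=> Ix; rewrite term_ge0 ?poweR_ge0// powR_ge0.
have B0 x : Iol l x ->
    0 <= ((fun u => Fp u * (w (q * u)%R)%:E * (u `^ -1)%:E) \_ D) x.
  move=> Ix; rewrite patchE; case: ifPn => // /set_mem Du.
  by rewrite term_ge0 ?poweR_ge0// wq_ge0.
rewrite hardy_lhsE (_ : B = \int[mu]_(u in Iol l)
    ((fun u => Fp u * (w (q * u)%R)%:E * (u `^ -1)%:E) \_ D) u); last first.
  by rewrite -integral_mkcondr setIidr//; exact: Iol_scaled_sub.
rewrite -ge0_integralZl_EFin// -ge0_integralD//; last 2 first.
  by move=> u Du; rewrite mule_ge0 ?lee_fin//; exact: I1_0.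
  by apply: emeasurable_funM.
apply: ge0_le_integral => //.
- by move=> x Ix; rewrite term_ge0 ?poweR_ge0// hardy_weight_ge0.
- apply: measurable_mulEFin; last exact: measurable_powRS.
  by apply: measurable_mulEFin => //; exact: measurable_hardy_weight.
- by apply: emeasurable_funD => //; apply: emeasurable_funM.
- move=> x Ix; have [x0 xl] := Ix; rewrite patchE.
  have x10 : 0 <= (x `^ -1)%:E by rewrite lee_fin powR_ge0.
  have -> : (1 - q `^ (- a))%:E * (Fp x * (x `^ (- a))%:E * (x `^ -1)%:E) =
      Fp x * ((1 - q `^ (- a)) * x `^ (- a))%:E * (x `^ -1)%:E.
    by rewrite muleA EFinM; congr (_ * _); rewrite muleCA.
  case: ifPn => [/set_mem Dx|/negP Dx].
  + rewrite -ge0_muleDl// ?mule_ge0 ?poweR_ge0 ?lee_fin ?wq_ge0 ?mulr_ge0 ?powR_ge0//.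
    rewrite -ge0_muleDr ?lee_fin ?wq_ge0 ?mulr_ge0 ?powR_ge0//.
    by rewrite -EFinD -hardy_weight_scale.
  + rewrite add0e lee_wpmul2r// lee_wpmul2l ?poweR_ge0// lee_fin.
    apply: hardy_weight_scale_le => //; rewrite leNgt; apply/negP => qxl.
    by apply: Dx; apply/mem_set; split => //; rewrite mulr_gt0.
Qed.

Lemma hardy_scaled_ge : (1 <= p)%R -> hardy_lhs p a l f < +oo ->
  (1 - q `^ (- p))%:E * hardy_rhs_int p a l f <=
  (1 - q `^ (- a))%:E * hardy_lhs p a l f.
Proof.
move=> p1 Ioo; have := le_trans (increment_ge p1) weight_le.
rewrite leeD2lE// ge0_fin_numE; last first.
  by apply: integral_ge0 => u Du; rewrite term_ge0 ?poweR_ge0// wq_ge0.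
exact: le_lt_trans scaled_integral_le_lhs Ioo.
Qed.

(** The increment of F^p is at most (q^p - 1) (u f(u))^p, with f taken at u and the weight at qu.
    Replacing w(qu) by the larger w(u) and enlarging (0, l/q) to (0,l) bounds the integral by J. *)
Let increment_le : (p <= 1)%R ->
  A <= B + (q `^ p - 1)%:E * hardy_rhs_int p a l f.
Proof.
move=> p1.
have qp : (0 <= q `^ p - 1)%R.
  rewrite subr_ge0; have := ler_powR (ltW q1) (ltW p0); rewrite powRr0.
  exact.
have mh1 : measurable_fun D (fun u => ((u * f u) `^ p * w (q * u))%:E * (u `^ -1)%:E).
  apply: measurable_mulEFin; last exact: measurable_powRS.
  apply/measurable_EFinP/measurable_funM => //.
  apply: (measurableT_comp (measurable_powR p)); apply: measurable_funM => //.
  apply: (@measurable_funS _ _ _ _ (Iol l)); first exact: measurable_Iol.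
    exact: Iol_scaled_sub.
  by case: adm.
have h10 u : D u -> 0 <= ((u * f u) `^ p * w (q * u))%:E * (u `^ -1)%:E.
  by move=> Du; rewrite -EFinM lee_fin !mulr_ge0 ?powR_ge0// wq_ge0.
apply: (@le_trans _ _ (B + (q `^ p - 1)%:E *
  \int[mu]_(u in D) (((u * f u) `^ p * w (q * u))%:E * (u `^ -1)%:E))).
  rewrite -ge0_integralZl_EFin// -ge0_integralD//.
  - rewrite weighted_integral_scale; apply: ge0_le_integral => //.
    + by move=> u Du; rewrite term_ge0 ?poweR_ge0// wq_ge0.
    + by apply: measurable_mulEFin => //; exact: measurable_powRS.
    + apply: emeasurable_funD.
        by apply: measurable_weighted => //; exact: measurable_powRS.
      by apply: emeasurable_funM.
    + move=> u Du; have u0 := Iol_scaled_gt0 Du.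
      have uqu : (u <= q * u)%R by rewrite ler_peMl// ltW.
      rewrite muleA -ge0_muleDl ?lee_fin ?powR_ge0//; last 2 first.
        by rewrite mule_ge0 ?poweR_ge0// lee_fin wq_ge0.
        by rewrite mulr_ge0// mulr_ge0 ?powR_ge0// wq_ge0.
      rewrite lee_wpmul2r ?lee_fin ?powR_ge0//.
      have fu0 : (0 <= f u)%R by case: adm => _ f0 _; exact/f0/Iol_scaled_sub.
      have -> : (q `^ p - 1)%:E * ((u * f u) `^ p * w (q * u))%:E =
          (f u `^ p * ((q * u) `^ p - u `^ p))%:E * (w (q * u))%:E.
        rewrite -!EFinM; congr (_%:E); rewrite mulrA; congr (_ * _)%R.
        by rewrite !(powRM p) ?(ltW q0) ?(ltW u0)//; ring.
      rewrite -ge0_muleDl ?poweR_ge0 ?lee_fin//; last first.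
        rewrite mulr_ge0 ?powR_ge0// subr_ge0.
        by rewrite ge0_ler_powR ?nnegrE ?mulr_ge0 ?(ltW p0) ?(ltW q0) ?(ltW u0).
      rewrite lee_wpmul2r ?lee_fin ?wq_ge0//.
      exact: (poweR_primitive_increment_le adm p0 p1 u0 uqu Du).
  - by move=> u Du; rewrite term_ge0 ?poweR_ge0// wq_ge0.
  - by apply: measurable_weighted => //; exact: measurable_powRS.
  - by move=> u Du; rewrite mule_ge0 ?lee_fin//; exact: h10.
  - by apply: emeasurable_funM.
rewrite leeD2l// lee_wpmul2l ?lee_fin// hardy_rhs_intE.
have mhI : measurable_fun (Iol l) (fun x => (h x)%:E * (x `^ -1)%:E).
  by apply: measurable_mulEFin; [exact/measurable_EFinP|exact: measurable_powRS].
apply: (@le_trans _ _ (\int[mu]_(x in D) ((h x)%:E * (x `^ -1)%:E))).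
  apply: ge0_le_integral => //.
  - apply: measurable_funS mhI; [exact: measurable_Iol|exact: Iol_scaled_sub].
  - move=> u Du; rewrite -!EFinM lee_fin !ler_wpM2r ?powR_ge0//.
    rewrite ler_wpM2l ?powR_ge0// hardy_weight_scale_nincr ?(ltW q1)//.
    exact: Iol_scaled_gt0.
apply: ge0_subset_integral => //; first exact: measurable_Iol.
- by move=> u Iu; rewrite -EFinM lee_fin mulr_ge0 ?powR_ge0// h_ge0.
- exact: Iol_scaled_sub.
Qed.

(** The scaling identity is available on (0, l/q) only, so [A] is first cut down to that interval;
    the part of I near l is lost here. *)
Let weight_ge : B + (1 - q `^ (- a))%:E *
  \int[mu]_(u in D) (Fp u * (u `^ (- a))%:E * (u `^ -1)%:E) <= A.
Proof.
have mI := measurable_Iol l.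
have qa : (0 <= 1 - q `^ (- a))%R.
  by rewrite subr_ge0 powRN_le1// ltW.
have mI1 : measurable_fun D (fun x => Fp x * (x `^ (- a))%:E * (x `^ -1)%:E).
  by apply: measurable_weighted => //; exact: measurable_powRS.
have I1_0 x : D x -> 0 <= Fp x * (x `^ (- a))%:E * (x `^ -1)%:E.
  by move=> Ix; rewrite term_ge0 ?poweR_ge0// powR_ge0.
rewrite -ge0_integralZl_EFin// -ge0_integralD//; last 4 first.
- by move=> u Du; rewrite term_ge0 ?poweR_ge0// wq_ge0.
- by apply: measurable_weighted => //; exact: measurable_powRS.
- by move=> u Du; rewrite mule_ge0 ?lee_fin//; exact: I1_0.
- by apply: emeasurable_funM.
apply: (@le_trans _ _ (\int[mu]_(u in D) (Fp u * (w u)%:E * (u `^ -1)%:E))).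
  rewrite le_eqVlt; apply/orP; left; apply/eqP; apply: eq_integral => x /set_mem Dx.
  have x0 := Iol_scaled_gt0 Dx.
  have x10 : 0 <= (x `^ -1)%:E by rewrite lee_fin powR_ge0.
  have -> : (1 - q `^ (- a))%:E * (Fp x * (x `^ (- a))%:E * (x `^ -1)%:E) =
      Fp x * ((1 - q `^ (- a)) * x `^ (- a))%:E * (x `^ -1)%:E.
    by rewrite muleA EFinM; congr (_ * _); rewrite muleCA.
  rewrite -ge0_muleDl// ?mule_ge0 ?poweR_ge0 ?lee_fin ?wq_ge0 ?mulr_ge0 ?powR_ge0//.
  rewrite -ge0_muleDr ?lee_fin ?wq_ge0 ?mulr_ge0 ?powR_ge0//.
  by rewrite -EFinD -hardy_weight_scale.
apply: ge0_subset_integral => //.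
- apply: measurable_mulEFin; last exact: measurable_powRS.
  by apply: measurable_mulEFin => //; exact: measurable_hardy_weight.
- by move=> x Ix; rewrite term_ge0 ?poweR_ge0// hardy_weight_ge0.
- exact: Iol_scaled_sub.
Qed.

Lemma hardy_scaled_le : (p <= 1)%R -> hardy_lhs p a l f < +oo ->
  (1 - q `^ (- a))%:E *
    \int[mu]_(u in D) (Fp u * (u `^ (- a))%:E * (u `^ -1)%:E) <=
  (q `^ p - 1)%:E * hardy_rhs_int p a l f.
Proof.
move=> p1 Ioo; have := le_trans weight_ge (increment_le p1).
rewrite leeD2lE// ge0_fin_numE; last first.
  by apply: integral_ge0 => u Du; rewrite term_ge0 ?poweR_ge0// wq_ge0.
exact: le_lt_trans scaled_integral_le_lhs Ioo.
Qed.

End scaled_inequalities.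

(** * Letting the ratio q tend to 1 *)

Section ratio_to_one.
Context {R : realType}.
Implicit Types (l : \bar R) (a p t : R) (f : R -> R).
Local Open Scope ereal_scope.

Lemma hardy_ge l a p f : 0 < l -> (0 < a)%R -> (1 <= p)%R -> admissible l f ->
  (p / a)%:E * hardy_rhs_int p a l f <= hardy_lhs p a l f.
Proof.
move=> l0 a0 p1 adm; have p0 : (0 < p)%R by exact: lt_le_trans p1.
have [->|Ineq] := eqVneq (hardy_lhs p a l f) +oo; first by rewrite leey.
have Ioo : hardy_lhs p a l f < +oo by rewrite lt_neqAle Ineq leey.
have J0 := hardy_rhs_int_ge0 p f l0 a0.
have I0 := hardy_lhs_ge0 l a p f.
have key q (q1 : (1 < q)%R) := hardy_scaled_ge l0 a0 p0 adm q1 p1 Ioo.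
have If : hardy_lhs p a l f \is a fin_num by rewrite ge0_fin_numE.
(* Any fixed ratio shows that J is finite; at q = 2 the factor 1 - 2^-p is positive, so an infinite
   J would force an infinite I. *)
have Jf : hardy_rhs_int p a l f \is a fin_num.
  rewrite ge0_fin_numE// ltNge leye_eq; apply/negP => /eqP Jy.
  have lt12 : (1 < 2 :> R)%R by rewrite ltr1n.
  have c0 : (0 < 1 - 2 `^ (- p) :> R)%R.
    rewrite subr_gt0 powRN invf_lt1 ?powR_gt0//.
    have := @gt0_ltr_powR R p p0 1%R 2%R; rewrite !nnegrE powR1; apply.
    - exact: ler01.
    - exact: ler0n.
    - exact: lt12.
  have := key 2%R lt12; rewrite Jy gt0_muley ?lte_fin//.
  by rewrite -(fineK If) -EFinM leye_eq.
move: key I0 J0; rewrite -(fineK If) -(fineK Jf) -EFinM !lee_fin.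
move: (fine _) (fine _) => I J key I0 J0.
(* The inequality reads -I (q^-a - 1) + J (q^-p - 1) >= 0; its derivative at q = 1 gives a I - p J
   >= 0. *)
have := @powR_combination_derive1_ge0 R (- I)%R J (- a)%R (- p)%R 2%R.
rewrite ltr1n => /(_ isT) h.
have {h} : (0 <= - I * - a + J * - p)%R.
  apply: h => q /andP[q1 _]; have := key q q1.
  rewrite -!EFinM lee_fin; clear; lra.
by move=> h; rewrite mulrAC ler_pdivrMr//; move: h; clear; lra.
Qed.

(** The left integral at ratio q runs over (0, l/q), which varies with q. Restricting it to a fixed
    (0,t) with t < l gives one quantity valid for all q close to 1. *)
Lemma hardy_le_sub l a p f t : 0 < l -> (0 < a)%R -> (0 < p)%R -> (p <= 1)%R ->
  admissible l f -> Iol l t -> hardy_lhs p a l f < +oo ->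
  hardy_lhs p a t%:E f <= (p / a)%:E * hardy_rhs_int p a l f.
Proof.
move=> l0 a0 p0 p1 adm It Ioo; have [t0 tl] := It.
(* For q < m/t one has qt < m < l, hence (0,t) lies inside (0, l/q). *)
have [m tm ml] : exists2 m, (t < m)%R & m%:E < l.
  move: tl; case: l {l0 adm It Ioo} => [r| |]// tr.
    move: tr; rewrite lte_fin => tr; exists ((t + r) / 2)%R.
      by move: tr; clear; lra.
    by rewrite lte_fin; move: tr; clear; lra.
  by exists (t + 1)%R; rewrite ?ltry// ltrDl.
have q01 : (1 < m / t)%R by rewrite ltr_pdivlMr// mul1r.
have J0 := hardy_rhs_int_ge0 p f l0 a0.
have pa0 : (0 < p / a)%R by rewrite divr_gt0.
have [->|Jneq] := eqVneq (hardy_rhs_int p a l f) +oo.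
  by rewrite gt0_muley ?lte_fin// leey.
have Jf : hardy_rhs_int p a l f \is a fin_num.
  by rewrite ge0_fin_numE// lt_neqAle Jneq leey.
have tq q : (1 < q < m / t)%R -> Iol t%:E `<=` Iol_scaled l q.
  move=> /andP[q1 qmt] u [u0 ut]; split.
    by rewrite mulr_gt0// (lt_trans _ q1).
  apply: le_lt_trans ml; rewrite lee_fin.
  move: qmt; rewrite ltr_pdivlMr// => /ltW; apply: le_trans.
  by rewrite ler_pM2l ?(lt_trans _ q1)//; move: ut; rewrite lte_fin => /ltW.
have subI : Iol t%:E `<=` Iol l.
  by move=> u [u0 ut]; apply: Iol_down It => //; move: ut; rewrite lte_fin => /ltW.
have mint : measurable_fun (Iol l)
    (fun u => primitive f u `^ p * (u `^ (- a))%:E * (u `^ (-1))%:E).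
  apply: measurable_weighted; last exact: measurable_powRS.
  exact: measurable_poweR_primitive.
have int_ge0 u : 0 <= primitive f u `^ p * (u `^ (- a))%:E * (u `^ (-1))%:E.
  by rewrite !mule_ge0 ?poweR_ge0// lee_fin powR_ge0.
have XI : hardy_lhs p a t%:E f <= hardy_lhs p a l f.
  rewrite !hardy_lhsE; apply: ge0_subset_integral => //; exact: measurable_Iol.
have X0 := hardy_lhs_ge0 t%:E a p f.
have Xf : hardy_lhs p a t%:E f \is a fin_num.
  by rewrite ge0_fin_numE// (le_lt_trans XI).
have key q : (1 < q < m / t)%R -> (1 - q `^ (- a))%:E * hardy_lhs p a t%:E f <=
    (q `^ p - 1)%:E * hardy_rhs_int p a l f.
  move=> qmt; have /andP[q1 _] := qmt.
  apply: le_trans (hardy_scaled_le l0 a0 p0 adm q1 p1 Ioo).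
  apply: lee_wpmul2l; first by rewrite lee_fin subr_ge0 powRN_le1// ltW.
  rewrite hardy_lhsE; apply: ge0_subset_integral => //.
  - exact: measurable_Iol.
  - exact: measurable_Iol_scaled.
  - apply: measurable_funS mint; first exact: measurable_Iol.
    exact: Iol_scaled_sub.
  - exact: tq.
move: key X0 J0; rewrite -(fineK Xf) -(fineK Jf) -EFinM !lee_fin.
move: (fine _) (fine _) => J X key X0 J0.
have := @powR_combination_derive1_ge0 R J X p (- a)%R _ q01.
move=> h; have {h} : (0 <= J * p + X * - a)%R.
  apply: h => q qmt; have := key q qmt.
  rewrite -!EFinM lee_fin; clear; lra.
by move=> h; rewrite mulrAC ler_pdivlMr//; move: h; clear; lra.
Qed.

End ratio_to_one.

(** * Integrals of powers *)

Section powR_integrals.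
Context {R : realType}.
Local Notation mu := (@lebesgue_measure R).
Local Open Scope ereal_scope.

Lemma integral_powR_co (s x y : R) : s != 0%R -> (0 < x)%R -> (x <= y)%R ->
  \int[mu]_(t in `[x, y[) (t `^ (s - 1))%:E = ((y `^ s - x `^ s) / s)%:E.
Proof.
move=> s0 x0; rewrite le_eqVlt => /predU1P[<-|xy].
  by rewrite set_itvco0 integral_set0 subrr mul0r.
have pos (t : R) : (x <= t)%R -> (0 < t)%R by exact: lt_le_trans.
have d (t : R) : (0 < t)%R ->
    is_derive t (1%R : R) (s^-1 *: (@powR R ^~ s)) (t `^ (s - 1))%R.
  move=> t0; have := is_deriveZ s^-1 (is_derive1_powR s t0).
  by rewrite /GRing.scale /= mulrA mulVf// mul1r.
have c r (t : R) : (0 < t)%R -> {for t, continuous (@powR R ^~ r)}.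
  move=> t0; apply/differentiable_continuous/derivable1_diffP.
  by apply: derivable_powR; rewrite in_itv/= t0.
have cF (t : R) : (0 < t)%R -> {for t, continuous (s^-1 *: (@powR R ^~ s))}.
  move=> t0; apply/differentiable_continuous/derivable1_diffP.
  by have [] := d t t0.
rewrite integral_itv_bndo_bndc; last first.
  by apply/measurable_EFinP; exact: measurable_funS (measurable_powR _).
rewrite (@continuous_FTC2 _ _ (s^-1 *: (@powR R ^~ s)) _ _ xy).
- by rewrite -EFinB -scalerBr /GRing.scale/= mulrC.
- apply: continuous_in_subspaceT => t /set_mem /=; rewrite in_itv/= => /andP[xt _].
  exact/c/pos.
- split.
  + move=> t; rewrite in_itv/= => /andP[/ltW/pos t0 _].
    by have [] := d t t0.
  + by apply: cvg_at_right_filter; exact: cF.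
  + by apply: cvg_at_left_filter; apply: cF; exact: lt_trans xy.
- move=> t; rewrite in_itv/= => /andP[/ltW/pos t0 _].
  by rewrite derive1E; have [_ ->] := d t t0.
Qed.

Lemma cvg_harmonic_powR (s : R) : (0 < s)%R ->
  (harmonic n `^ s)%R @[n --> \oo] --> (0%R : R).
Proof.
move=> s0; have /cvg_at_rightP h := powR_cvg0 s0; apply: h; split.
  by move=> n; rewrite invr_gt0.
exact: cvg_harmonic.
Qed.

(** Monotone convergence along [c/(n+1), c): the contribution of the lower end vanishes in the limit
    because s > 0. *)
Lemma integral_powR_Iol (s c : R) : (0 < s)%R -> (0 < c)%R ->
  \int[mu]_(x in Iol c%:E) (x `^ (s - 1))%:E = (c `^ s / s)%:E.
Proof.
move=> s0 c0.
have ch_gt0 n : (0 < c * harmonic n)%R by rewrite mulr_gt0// invr_gt0.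
have ch_le n : (c * harmonic n <= c)%R.
  by rewrite ler_piMr ?(ltW c0)// invf_le1// ler1n.
rewrite (_ : Iol c%:E = \bigcup_n `[(c * harmonic n)%R, c[%classic); last first.
  apply/seteqP; split => x.
    move=> [x0]; rewrite lte_fin => xc.
    have [n xn] : exists n, (c / x < n.+1%:R)%R.
      exists (Num.truncn (c / x)); exact: truncnS_gt.
    exists n => //=; rewrite in_itv/= xc andbT ler_pdivrMr//.
    by move: xn; rewrite ltr_pdivrMr// mulrC => /ltW.
  move=> [n _] /=; rewrite in_itv/= => /andP[cx xc]; split.
    exact: lt_le_trans (ch_gt0 n) cx.
  by rewrite lte_fin.
have h := @ge0_nondecreasing_set_cvg_integral _ (measurableTypeR R) R
  (fun n => `[(c * harmonic n)%R, c[%classic) (fun x => (x `^ (s - 1))%:E) mu.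
rewrite -(cvg_lim _ (h _ _ _ _))//; last 3 first.
- move=> m n mn; apply/subsetPset; apply: subset_itvr; rewrite bnd_simp.
  by rewrite ler_pM2l// lef_pV2 ?posrE// ler_nat.
- by move=> n; apply/measurable_EFinP; exact: measurable_powRS.
- by move=> n x _; rewrite lee_fin powR_ge0.
apply/cvg_lim => //.
under eq_fun do rewrite integral_powR_co ?gt_eqF//.
apply: cvg_EFin; first by near=> n.
rewrite /comp /=; apply: cvgMl.
rewrite -[X in _ --> X]subr0; apply: cvgB; first exact: cvg_cst.
rewrite -(mulr0 (c `^ s)%R).
under eq_fun do rewrite powRM ?(ltW c0) ?invr_ge0//.
by apply: cvgMr; exact: cvg_harmonic_powR.
Unshelve. all: by end_near. Qed.

(** For finite l this is a single interval. For l = +oo the intervals [c, c(n+1)) exhaust the ray,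
    and the upper terms tend to 0, the value of [endpoint_pow] there. *)
Lemma integral_powRN_ge (l : \bar R) (a c : R) : (0 < a)%R -> (0 < c)%R -> c%:E < l ->
  \int[mu]_(x in [set x | (c <= x)%R /\ x%:E < l]) (x `^ (- a - 1))%:E =
  ((c `^ (- a) - endpoint_pow l a) / a)%:E.
Proof.
move=> a0 c0; rewrite /endpoint_pow; case: l => [r| |]//.
  rewrite lte_fin => cr.
  rewrite (_ : [set x | _] = `[c, r[%classic); last first.
    by apply/seteqP; split => x /=; rewrite in_itv/= lte_fin => /andP.
  rewrite integral_powR_co ?(ltW cr)// ?oppr_eq0 ?gt_eqF//.
  by congr (_%:E); rewrite invrN mulrN -mulNr opprB.
move=> _.
have ch_ge n : (c <= c / harmonic n)%R.
  by rewrite invrK ler_peMr ?(ltW c0)// ler1n.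
rewrite (_ : [set x | _] = \bigcup_n `[c, (c / harmonic n)%R[%classic); last first.
  apply/seteqP; split => x.
    move=> [cx _].
    have [n xn] : exists n, (x / c < n.+1%:R)%R.
      exists (Num.truncn (x / c)); exact: truncnS_gt.
    exists n => //=; rewrite in_itv/= cx /= invrK.
    by move: xn; rewrite ltr_pdivrMr// mulrC.
  by move=> [n _] /=; rewrite in_itv/= => /andP[cx xc]; rewrite ltry.
have h := @ge0_nondecreasing_set_cvg_integral _ (measurableTypeR R) R
  (fun n => `[c, (c / harmonic n)%R[%classic) (fun x => (x `^ (- a - 1))%:E) mu.
rewrite -(cvg_lim _ (h _ _ _ _))//; last 3 first.
- move=> m n mn; apply/subsetPset; apply: subset_itvl; rewrite bnd_simp.
  by rewrite !invrK ler_pM2l// ler_nat.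
- by move=> n; apply/measurable_EFinP; exact: measurable_powRS.
- by move=> n x _; rewrite lee_fin powR_ge0.
apply/cvg_lim => //.
under eq_fun do rewrite integral_powR_co ?oppr_eq0 ?gt_eqF//.
apply: cvg_EFin; first by near=> n.
rewrite /comp /=.
under eq_fun do rewrite invrN mulrN -mulNr opprB.
apply: cvgMl; apply: cvgB; first exact: cvg_cst.
rewrite -(mulr0 (c `^ (- a))%R).
under eq_fun do rewrite powRM ?(ltW c0) ?invrK ?ler0n// -(invrK _.+1%:R)
  powR_inv ?invr_ge0// opprK.
by apply: cvgMr; exact: cvg_harmonic_powR.
Unshelve. all: by end_near. Qed.

End powR_integrals.

(** * Bounded functions, finiteness and monotonicity in the data *)

Section truncation.
Context {R : realType}.
Local Notation mu := (@lebesgue_measure R).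
Implicit Types (l : \bar R) (a p t m N : R) (f g : R -> R).
Local Open Scope ereal_scope.

Lemma powRD_gt0 (x r s : R) : (0 < x)%R -> (x `^ (r + s) = x `^ r * x `^ s)%R.
Proof. by move=> x0; rewrite powRD// (gt_eqF x0) implybT. Qed.

Lemma admissible_sub l m f : Iol l m -> admissible l f -> admissible m%:E f.
Proof.
move=> Im [mf f0 fni].
have sub : Iol m%:E `<=` Iol l.
  by move=> u [u0 um]; apply: Iol_down Im => //; move: um; rewrite lte_fin => /ltW.
split.
- by apply: measurable_funS mf => //; exact: measurable_Iol.
- by move=> x /sub; exact: f0.
- by move=> x y /sub Ix /sub Iy; exact: fni.
Qed.

Lemma admissible_truncate l f N : (0 <= N)%R -> admissible l f ->
  admissible l (fun x => Num.min (f x) N).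
Proof.
move=> N0 [mf f0 fni]; split.
- by apply: measurable_minr => //; exact: measurable_cst.
- by move=> x Ix; rewrite le_min f0.
- by move=> x y Ix Iy xy; rewrite le_min !ge_min lexx orbT andbT fni.
Qed.

(** From f <= N follows F(x) <= N x, so the integrand is at most N^p x^(p-a-1), which is integrable
    at 0 because a < p. *)
Lemma hardy_lhs_lty m a p f N : (0 < m)%R -> (0 < p)%R -> (a < p)%R ->
  admissible m%:E f -> (forall x, Iol m%:E x -> (f x <= N)%R) ->
  hardy_lhs p a m%:E f < +oo.
Proof.
move=> m0 p0 ap adm fN; have [mf f0 fni] := adm.
have pa0 : (0 < p - a)%R by rewrite subr_gt0.
have N0 : (0 <= N)%R.
  have Im : Iol m%:E (m / 2)%R.
    by split; rewrite ?lte_fin; move: m0; clear; lra.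
  exact: le_trans (f0 _ Im) (fN _ Im).
have FN x : Iol m%:E x -> primitive f x <= (N * x)%:E.
  move=> Ix; have [x0 _] := Ix.
  have sub y : (0 < y < x)%R -> Iol m%:E y.
    by move=> /andP[y0 /ltW yx]; exact: Iol_down Ix.
  apply: (@le_trans _ _ (\int[mu]_(y in `]0%R, x[) N%:E)).
    apply: ge0_le_integral => //.
    - by move=> y /=; rewrite in_itv/= => /sub Iy; rewrite lee_fin f0.
    - exact: (admissible_measurable_sub adm).
    - by move=> y /=; rewrite in_itv/= => /sub Iy; rewrite lee_fin fN.
  rewrite EFinM (_ : x%:E = mu `]0%R, x[%classic); first by rewrite integral_cst.
  by rewrite lebesgue_measure_itv/= lte_fin x0 -EFinB subr0.
apply: (@le_lt_trans _ _
  (\int[mu]_(x in Iol m%:E) ((N `^ p)%:E * (x `^ (p - a - 1))%:E))).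
  rewrite hardy_lhsE; apply: ge0_le_integral.
  - exact: measurable_Iol.
  - by move=> x _; rewrite !mule_ge0 ?poweR_ge0 ?lee_fin ?powR_ge0.
  - apply: measurable_weighted; last exact: measurable_powRS.
    exact: measurable_poweR_primitive.
  - apply: emeasurable_funM => //; apply/measurable_EFinP; exact: measurable_powRS.
  - move=> x Ix; have [x0 _] := Ix.
    rewrite (_ : _ `^ (_ - 1) = x `^ p * (x `^ (- a) * x `^ -1))%R; last first.
      by rewrite -!(powRD_gt0 _ _ x0) addrA.
    rewrite -muleA -EFinM [X in _ <= _ * X]EFinM muleA.
    rewrite lee_wpmul2r ?lee_fin ?mulr_ge0 ?powR_ge0//.
    rewrite -EFinM -(powRM _ N0 (ltW x0)) -poweR_EFin.
    apply: gt0_ler_poweR; rewrite ?(ltW p0)//.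
    - by rewrite in_itv/= leey (primitive_ge0 adm).
    - by rewrite in_itv/= leey lee_fin mulr_ge0 ?(ltW x0).
    - exact: FN.
rewrite ge0_integralZl_EFin ?powR_ge0//.
- by rewrite integral_powR_Iol// -EFinM ltry.
- exact: measurable_Iol.
- by move=> x _; rewrite lee_fin powR_ge0.
- by apply/measurable_EFinP; exact: measurable_powRS.
Qed.

(** Three effects point the same way: the function shrinks, the interval shrinks, and the weight
    shrinks because m^-a >= l^-a for m < l. *)
Lemma le_hardy_rhs_int l m a p f g : 0 < l -> (0 < a)%R -> (0 < p)%R ->
  Iol l m -> admissible m%:E g -> admissible l f ->
  (forall x, Iol m%:E x -> (g x <= f x)%R) ->
  hardy_rhs_int p a m%:E g <= hardy_rhs_int p a l f.
Proof.
move=> l0 a0 p0 Im admg admf gf; have [m0 _] := Im.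
have sub : Iol m%:E `<=` Iol l.
  by move=> u [u0 um]; apply: Iol_down Im => //; move: um; rewrite lte_fin => /ltW.
have meas k (e : R -> R) : admissible k e -> measurable_fun (Iol k)
    (fun x => ((x * e x) `^ p * hardy_weight k a x)%:E * (x `^ -1)%:E).
  move=> [me _ _]; apply: measurable_mulEFin; last exact: measurable_powRS.
  apply/measurable_EFinP; apply: measurable_funM; last exact: measurable_hardy_weight.
  by apply: (measurableT_comp (measurable_powR p)); apply: measurable_funM.
have ml := meas l f admf; have mm := meas m%:E g admg.
have ge0 x : Iol l x ->
    0 <= ((x * f x) `^ p * hardy_weight l a x)%:E * (x `^ -1)%:E.
  by move=> Ix; rewrite -EFinM lee_fin !mulr_ge0 ?powR_ge0// hardy_weight_ge0.
rewrite !hardy_rhs_intE//.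
apply: (@le_trans _ _ (\int[mu]_(x in Iol m%:E)
   (((x * f x) `^ p * hardy_weight l a x)%:E * (x `^ -1)%:E))).
  apply: ge0_le_integral.
  - exact: measurable_Iol.
  - by move=> x Ix; rewrite -EFinM lee_fin !mulr_ge0 ?powR_ge0// hardy_weight_ge0.
  - exact: mm.
  - by apply: measurable_funS ml => //; exact: measurable_Iol.
  - move=> x Ix; have [x0 _] := Ix; rewrite -!EFinM lee_fin.
    have g0 : (0 <= g x)%R by case: admg => _ + _; apply.
    have fg : (g x <= f x)%R by exact: gf.
    rewrite ler_wpM2r ?powR_ge0// ler_pM ?powR_ge0 ?hardy_weight_ge0//.
      rewrite ge0_ler_powR ?nnegrE ?(ltW p0) ?mulr_ge0 ?(ltW x0)//.
        exact: le_trans fg.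
      by rewrite ler_pM2l.
    by rewrite /hardy_weight lerD2l lerN2 -subr_ge0 (hardy_weight_ge0 a0 Im).
by apply: ge0_subset_integral => //; exact: measurable_Iol.
Qed.

(** On [0,+oo] the power p is an increasing bijection with inverse the power 1/p, so it commutes
    with suprema, an infinite limit included. *)
Lemma cvg_poweR_nondecreasing (u : (\bar R)^nat) (L : \bar R) p : (0 < p)%R ->
  (forall n, 0 <= u n) -> nondecreasing_seq u -> u @ \oo --> L ->
  (u n `^ p) @[n --> \oo] --> L `^ p.
Proof.
move=> p0 u0 und uL.
have pw q (x y : \bar R) : (0 <= q)%R -> 0 <= x -> x <= y -> x `^ q <= y `^ q.
  move=> q0 x0 xy; apply: gt0_ler_poweR => //; rewrite in_itv/= leey andbT//.
  exact: le_trans xy.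
have pK (x : \bar R) : 0 <= x -> (x `^ p) `^ p^-1 = x.
  by move=> x0; rewrite -poweRrM mulfV ?gt_eqF// poweRe1.
have pK' (x : \bar R) : 0 <= x -> (x `^ p^-1) `^ p = x.
  by move=> x0; rewrite -poweRrM mulVf ?gt_eqF// poweRe1.
have und' : nondecreasing_seq (fun n => u n `^ p).
  by move=> i j ij; apply: pw; rewrite ?(ltW p0)// und.
rewrite -(cvg_lim _ uL)// (cvg_lim _ (ereal_nondecreasing_cvgn und))//.
set S := ereal_sup (range u).
have uS n : u n <= S by apply: ereal_sup_ubound; exists n.
have S0 : 0 <= S by exact: le_trans (uS 0%N).
have := ereal_nondecreasing_cvgn und'; set T := ereal_sup _ => uT.
have TE : T == S `^ p.
  rewrite eq_le; apply/andP; split.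
    apply: ge_ereal_sup => _ [n _ <-]; apply: pw; rewrite ?(ltW p0)//.
  have uTn n : u n `^ p <= T by apply: ereal_sup_ubound; exists n.
  have T0 : 0 <= T by apply: le_trans (uTn 0%N); exact: poweR_ge0.
  rewrite -(pK' T T0); apply: (pw p); rewrite ?(ltW p0)//.
  apply: ge_ereal_sup => _ [n _ <-]; rewrite -(pK (u n))//.
  by apply: pw; rewrite ?invr_ge0 ?(ltW p0)// poweR_ge0.
by rewrite -(eqP TE).
Qed.

End truncation.

(** * The case p <= 1 by monotone limits *)

Section hardy_le_limit.
Context {R : realType}.
Local Notation mu := (@lebesgue_measure R).
Implicit Types (l M : \bar R) (a p t : R) (f : R -> R).
Local Open Scope ereal_scope.

Let truncate f (n : nat) (x : R) : R := Num.min (f x) n%:R.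

Lemma cvg_truncate f x : (truncate f n x)%:E @[n --> \oo] --> (f x)%:E.
Proof.
apply: cvg_near_cst; near=> n; rewrite /truncate min_l//.
by near: n; exact: nbhs_infty_ger.
Unshelve. all: by end_near. Qed.

Lemma cvg_primitive_truncate l f x : admissible l f -> Iol l x ->
  primitive (truncate f n) x @[n --> \oo] --> primitive f x.
Proof.
move=> adm Ix.
have sub y : (0 < y < x)%R -> Iol l y.
  by move=> /andP[y0 /ltW yx]; exact: Iol_down Ix.
have trunc n : admissible l (truncate f n) by exact: admissible_truncate.
rewrite {2}/primitive (_ : \int[_]_(y in _) _ =
    \int[mu]_(y in `]0%R, x[) limn (fun n => (truncate f n y)%:E)).
  apply: cvg_monotone_convergence => //.
  - by move=> n; apply: (admissible_measurable_sub (trunc n)).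
  - move=> n y /=; rewrite in_itv/= => /sub Iy; rewrite lee_fin.
    by case: (trunc n) => _ + _; exact.
  - move=> y _ i j ij; rewrite lee_fin /truncate le_min !ge_min lexx /=.
    by rewrite ler_nat ij orbT.
apply: eq_integral => y _; apply/esym/cvg_lim => //; exact: cvg_truncate.
Qed.

(** Monotone convergence is applied twice: inside, to the primitives of the truncations, and
    outside, to the integral of their powers. *)
Lemma hardy_lhs_truncate_le l a p f M : (0 < p)%R -> admissible l f ->
  (forall n, hardy_lhs p a l (truncate f n) <= M) -> hardy_lhs p a l f <= M.
Proof.
move=> p0 adm ltM.
have trunc n : admissible l (truncate f n) by exact: admissible_truncate.
pose g n x := primitive (truncate f n) x `^ p * (x `^ (- a))%:E * (x `^ -1)%:E.
have prim_nd x : Iol l x -> nondecreasing_seq (fun n => primitive (truncate f n) x).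
  move=> Ix i j ij.
  have sub y : (0 < y < x)%R -> Iol l y.
    by move=> /andP[y0 /ltW yx]; exact: Iol_down Ix.
  apply: ge0_le_integral => //.
  - move=> y /=; rewrite in_itv/= => /sub Iy; rewrite lee_fin.
    by case: (trunc i) => _ + _; exact.
  - by apply: (admissible_measurable_sub (trunc i)).
  - by apply: (admissible_measurable_sub (trunc j)).
  - move=> y _; rewrite lee_fin /truncate le_min !ge_min lexx /=.
    by rewrite ler_nat ij orbT.
have mg n : measurable_fun (Iol l) (g n).
  apply: measurable_weighted; last exact: measurable_powRS.
  exact: measurable_poweR_primitive.
have g0 n x : Iol l x -> 0 <= g n x.
  by move=> _; rewrite !mule_ge0 ?poweR_ge0// lee_fin powR_ge0.
have gnd x : Iol l x -> nondecreasing_seq (g ^~ x).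
  move=> Ix i j ij; rewrite /g !lee_wpmul2r ?lee_fin ?powR_ge0//.
  have Pi : 0 <= primitive (truncate f i) x by exact: (primitive_ge0 (trunc i) Ix).
  have Pj : 0 <= primitive (truncate f j) x by exact: (primitive_ge0 (trunc j) Ix).
  by apply: gt0_ler_poweR; rewrite ?(ltW p0) ?in_itv/= ?leey ?andbT//; exact: prim_nd.
have cvgg x : Iol l x ->
    g n x @[n --> \oo] --> primitive f x `^ p * (x `^ (- a))%:E * (x `^ -1)%:E.
  move=> Ix; apply: cvgeZr => //; apply: cvgeZr => //.
  apply: cvg_poweR_nondecreasing => //.
  - by move=> n; exact: (primitive_ge0 (trunc n) Ix).
  - exact: prim_nd.
  - exact: cvg_primitive_truncate adm Ix.
have h := @cvg_monotone_convergence _ (measurableTypeR R) R mu _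
  (measurable_Iol l) _ mg g0 gnd.
rewrite hardy_lhsE (_ : \int[_]_(y in _) _ =
    \int[mu]_(x in Iol l) limn (g ^~ x)); last first.
  apply: eq_integral => x /set_mem Ix; apply/esym/cvg_lim => //; exact: cvgg.
rewrite -(cvg_lim _ h)//; apply: lime_le; first by apply/cvg_ex; eexists; exact: h.
by near=> n; have := ltM n; rewrite hardy_lhsE.
Unshelve. all: by end_near. Qed.

Lemma Iol_exhaustion l : 0 < l -> exists t : R^nat,
  [/\ (forall n, Iol l (t n)), {homo t : m n / (m <= n)%N >-> (m <= n)%R} &
      forall x, Iol l x -> exists n, (x < t n)%R].
Proof.
case: l => [r| |]// l0.
- move: l0; rewrite lte_fin => r0.
  (* The shift to n + 2 makes the first point r/2; with n + 1 it would be 0, outside the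
     interval. *)
  exists (fun n => r - r / n.+2%:R)%R; split.
  + move=> n; split; last by rewrite lte_fin gtrBl divr_gt0.
    by rewrite subr_gt0 ltr_pdivrMr// ltr_pMr// ltr1n.
  + move=> m n mn; rewrite lerD2l lerN2 ler_pM2l// lef_pV2 ?posrE//.
    by rewrite ler_nat !ltnS.
  + move=> x [x0]; rewrite lte_fin => xr.
    exists (Num.truncn (r / (r - x))); rewrite ltrBrDl -ltrBrDr.
    have rx0 : (0 < r - x)%R by rewrite subr_gt0.
    rewrite ltr_pdivrMr// mulrC -ltr_pdivrMr//.
    by apply: lt_trans (truncnS_gt _) _; rewrite ltr_nat.
- exists (fun n => n.+1%:R); split.
  + by move=> n; split => //; rewrite ltry.
  + by move=> m n mn; rewrite ler_nat.
  + by move=> x _; exists (Num.truncn x); exact: truncnS_gt.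
Qed.

Lemma hardy_lhs_exhaustion_le l a p f M : 0 < l -> admissible l f ->
  (forall t, Iol l t -> hardy_lhs p a t%:E f <= M) -> hardy_lhs p a l f <= M.
Proof.
move=> l0 adm tM; have [t [It tnd tl]] := Iol_exhaustion l0.
have sub n : Iol (t n)%:E `<=` Iol l.
  move=> u [u0 ut]; apply: Iol_down (It n) => //.
  by move: ut; rewrite lte_fin => /ltW.
rewrite hardy_lhsE (_ : Iol l = \bigcup_n Iol (t n)%:E); last first.
  apply/seteqP; split => x; last by move=> [n _] /sub.
  move=> Ix; have [n xn] := tl _ Ix; exists n => //.
  by case: Ix.
have h := @ge0_nondecreasing_set_cvg_integral _ (measurableTypeR R) R
  (fun n => Iol (t n)%:E)
  (fun x => primitive f x `^ p * (x `^ (- a))%:E * (x `^ -1)%:E) mu.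
have cvgh : \int[mu]_(x in Iol (t n)%:E)
    (primitive f x `^ p * (x `^ (- a))%:E * (x `^ -1)%:E) @[n --> \oo] -->
  \int[mu]_(x in \bigcup_n Iol (t n)%:E)
    (primitive f x `^ p * (x `^ (- a))%:E * (x `^ -1)%:E).
  apply: h.
  - move=> m n mn; apply/subsetPset => x [x0 xm]; split => //.
    by apply: lt_le_trans xm _; rewrite lee_fin tnd.
  - by move=> n; exact: measurable_Iol.
  - move=> n; apply: (@measurable_funS _ _ _ _ (Iol l)) => //.
      exact: measurable_Iol.
    apply: measurable_weighted; last exact: measurable_powRS.
    exact: measurable_poweR_primitive.
  - by move=> n x _; rewrite !mule_ge0 ?poweR_ge0// lee_fin powR_ge0.
rewrite -(cvg_lim _ cvgh)//; apply: lime_le; first by apply/cvg_ex; eexists; exact: cvgh.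
by near=> n; have := tM _ (It n); rewrite hardy_lhsE.
Unshelve. all: by end_near. Qed.

(** For t < m < l and a truncation of f, the left integral on (0,m) is finite, so the restricted
    inequality applies with m as end point. Its right side is bounded by J for f on (0,l),
    independently of t, m and the truncation level, so both limits can be taken. *)
Lemma hardy_le l a p f : 0 < l -> (0 < a)%R -> (a < p)%R -> (p <= 1)%R ->
  admissible l f -> hardy_lhs p a l f <= (p / a)%:E * hardy_rhs_int p a l f.
Proof.
move=> l0 a0 ap p1 adm; have p0 : (0 < p)%R by exact: lt_trans ap.
have pa0 : (0 <= p / a)%R by rewrite divr_ge0// ltW.
apply: hardy_lhs_exhaustion_le => // t It.
have [s [Is _ sl]] := Iol_exhaustion l0.
have [n tn] := sl _ It; move: (s n) (Is n) tn => m Im tm.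
apply: hardy_lhs_truncate_le => // [|k]; first exact: admissible_sub adm.
have admk : admissible m%:E (truncate f k).
  by apply: admissible_truncate => //; exact: admissible_sub adm.
have m0 : (0 < m)%R by case: Im.
apply: (@le_trans _ _ ((p / a)%:E * hardy_rhs_int p a m%:E (truncate f k))).
  apply: hardy_le_sub => //.
  - by split => //; case: It.
  - apply: (@hardy_lhs_lty _ _ _ _ _ k%:R) => // x _.
    by rewrite /truncate ge_min lexx orbT.
apply: lee_wpmul2l; first by rewrite lee_fin.
apply: le_hardy_rhs_int => // x _.
by rewrite /truncate ge_min lexx.
Qed.

End hardy_le_limit.

(** * Explicit integrals for A chi_(0,c) *)

Section indicator.
Context {R : realType}.
Local Notation mu := (@lebesgue_measure R).
Variables (l : \bar R) (a p c A : R).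
Hypotheses (l0 : (0 < l)%E) (a0 : 0 < a) (ap : a < p) (c0 : 0 < c)
  (cl : (c%:E < l)%E) (A0 : 0 < A).
Let p0 : 0 < p. Proof. exact: lt_trans ap. Qed.
Let pa0 : 0 < p - a. Proof. by rewrite subr_gt0. Qed.
Local Notation f := (fun x => (A * \1_(`]0, c[ : set R) x)%R).
Local Open Scope ereal_scope.

Let f_lt (x : R) : (0 < x < c)%R -> (A * \1_(`]0%R, c[ : set R) x)%R = A.
Proof. by move=> x0c; rewrite indicE mem_set ?mulr1//= in_itv/=. Qed.

Let f_ge (x : R) : (c <= x)%R -> (A * \1_(`]0%R, c[ : set R) x)%R = 0%R.
Proof.
by move=> cx; rewrite indicE memNset ?mulr0//= in_itv/= => /andP[_]; rewrite ltNge cx.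
Qed.

Lemma admissible_indic : admissible l f.
Proof.
split.
- by apply: measurable_funM => //; exact: measurable_indic.
- by move=> x _ /=; rewrite mulr_ge0 ?(ltW A0).
- move=> x y [x0 _] [y0 _] xy /=; have [cx|xc] := leP c x.
    by rewrite !f_ge// (le_trans cx).
  rewrite (f_lt (x := x)) ?x0//; have [cy|yc] := leP c y.
    by rewrite f_ge// ltW.
  by rewrite f_lt// y0.
Qed.

Lemma primitive_indic (x : R) : (0 < x)%R -> primitive f x = (A * Num.min x c)%:E.
Proof.
move=> x0; rewrite /primitive.
under eq_integral do rewrite EFinM.
rewrite ge0_integralZl_EFin ?(ltW A0)//; last first.
  by apply/measurable_EFinP; exact: measurable_indic.
rewrite integral_indic// EFinM; congr (_ * _).
rewrite (_ : _ `&` _ = `]0%R, (Num.min x c)[%classic); last first.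
  apply/seteqP; split => y /=; rewrite !in_itv/= lt_min.
    by move=> [/andP[-> ->] /andP[_ ->]].
  by move=> /and3P[-> -> ->].
transitivity (mu `]0%R, (Num.min x c)[%classic); first by [].
by rewrite lebesgue_measure_itv/= lte_fin lt_min x0 c0 -EFinB subr0.
Qed.

Let integralZ_powR (k r : R) (D : set R) : measurable D -> (0 <= k)%R ->
  \int[mu]_(x in D) (k%:E * (x `^ r)%:E) = k%:E * \int[mu]_(x in D) (x `^ r)%:E.
Proof.
move=> mD k0; apply: ge0_integralZl_EFin => //.
- by move=> x _; rewrite lee_fin powR_ge0.
- by apply/measurable_EFinP; exact: measurable_powRS.
Qed.

Let subI : Iol c%:E `<=` Iol l.
Proof. by move=> x [x0 xc]; split => //; exact: lt_trans cl. Qed.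

(** The integral splits at c: F(x) = A x before c and F(x) = A c from c on, leaving a pure power on
    each side. *)
Lemma hardy_lhs_indic : hardy_lhs p a l f =
  (A `^ p * (c `^ (p - a) / (p - a) +
    c `^ p * ((c `^ (- a) - endpoint_pow l a) / a)))%:E.
Proof.
rewrite hardy_lhsE.
pose E := [set x : R | (c <= x)%R /\ x%:E < l].
have IE : Iol l = Iol c%:E `|` E.
  apply/seteqP; split => x.
    move=> [x0 xl]; have [cx|xc] := leP c x; first by right.
    by left; split => //; rewrite lte_fin.
  by move=> [/subI//|[cx xl]]; split => //; exact: lt_le_trans cx.
have mE : measurable E.
  apply: is_interval_measurable => s t [cs _] [_ tl] u /andP[su ut]; split.
    exact: le_trans su.
  by rewrite (le_lt_trans _ tl)// lee_fin.
have mint : measurable_fun (Iol l)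
    (fun x => primitive f x `^ p * (x `^ (- a))%:E * (x `^ (-1))%:E).
  apply: measurable_weighted; last exact: measurable_powRS.
  exact: measurable_poweR_primitive admissible_indic.
rewrite IE ge0_integral_setU -?IE//; last 3 first.
- exact: measurable_Iol.
- by move=> x _; rewrite !mule_ge0 ?poweR_ge0// lee_fin powR_ge0.
- apply/disj_setPS => x [] [_]; rewrite lte_fin => xc [cx _].
  by move: (lt_le_trans xc cx); rewrite ltxx.
rewrite mulrDr EFinD; congr (_ + _).
- transitivity (\int[mu]_(x in Iol c%:E) ((A `^ p)%:E * (x `^ (p - a - 1))%:E)).
    apply: eq_integral => x /set_mem[x0]; rewrite lte_fin => xc.
    rewrite primitive_indic// min_l ?(ltW xc)// poweR_EFin.
    rewrite (powRM _ (ltW A0) (ltW x0)) -!EFinM -!mulrA; congr (_ * _)%:E.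
    by rewrite !(powRD_gt0 _ _ x0) mulrA.
  rewrite integralZ_powR ?powR_ge0//; last exact: measurable_Iol.
  by rewrite integral_powR_Iol.
- transitivity (\int[mu]_(x in E) (((A * c) `^ p)%:E * (x `^ (- a - 1))%:E)).
    apply: eq_integral => x /set_mem[cx _].
    have x0 : (0 < x)%R by exact: lt_le_trans cx.
    rewrite primitive_indic// min_r// poweR_EFin -muleA -EFinM.
    by rewrite (powRD_gt0 _ _ x0).
  rewrite integralZ_powR ?powR_ge0//.
  by rewrite integral_powRN_ge// -EFinM (powRM _ (ltW A0) (ltW c0)) mulrA.
Qed.

Lemma hardy_rhs_int_indic : hardy_rhs_int p a l f =
  (A `^ p * (c `^ (p - a) / (p - a) - endpoint_pow l a * (c `^ p / p)))%:E.
Proof.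
have mI := measurable_Iol c%:E.
have L0 := endpoint_pow_ge0 l a.
pose L := endpoint_pow l a.
pose k x : R := (A `^ p * (x `^ p * hardy_weight l a x * x `^ -1))%R.
have k0 x : Iol c%:E x -> 0 <= (k x)%:E.
  move=> Ix; rewrite lee_fin /k !mulr_ge0 ?powR_ge0//.
  by rewrite hardy_weight_ge0//; exact: subI.
have mk : measurable_fun (Iol c%:E) (EFin \o k).
  apply/measurable_EFinP; apply: measurable_funM => //.
  apply: measurable_funM; last exact: measurable_powRS.
  by apply: measurable_funM; [exact: measurable_powRS|exact: measurable_hardy_weight].
rewrite hardy_rhs_intE//.
transitivity (\int[mu]_(x in Iol c%:E) (k x)%:E).
  rewrite -[in RHS](setIidr subI) [RHS]integral_mkcondr.
  apply: eq_integral => x /set_mem[x0 xl] /=; rewrite patchE.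
  case: ifPn => [/set_mem[_]|/negP xc].
    rewrite lte_fin => xc; rewrite f_lt ?x0// -EFinM /k; congr (_%:E).
    by rewrite (powRM _ (ltW x0) (ltW A0)); ring.
  rewrite f_ge; last first.
    rewrite leNgt; apply/negP => xc'; apply: xc; apply/mem_set.
    by split => //; rewrite lte_fin.
  by rewrite mulr0 powR0 ?gt_eqF// mul0r mul0e.
(* The weight is a difference, so the subtracted power integral is moved to the other side, where
   additivity holds for non-negative integrands; finiteness of the sum then allows subtraction. *)
have sum : \int[mu]_(x in Iol c%:E) (k x)%:E +
    (A `^ p * L * (c `^ p / p))%:E == (A `^ p * (c `^ (p - a) / (p - a)))%:E.
  apply/eqP; rewrite [in LHS]EFinM -(integral_powR_Iol p0 c0).
  rewrite -integralZ_powR ?mulr_ge0 ?powR_ge0//.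
  rewrite -ge0_integralD//; last 2 first.
  - by move=> x _; rewrite -EFinM lee_fin !mulr_ge0 ?powR_ge0.
  - by apply: emeasurable_funM => //; apply/measurable_EFinP; exact: measurable_powRS.
  rewrite [in RHS]EFinM -(integral_powR_Iol pa0 c0).
  rewrite -integralZ_powR ?powR_ge0//.
  apply: eq_integral => x /set_mem[x0 _]; rewrite -!EFinM -EFinD; congr (_%:E).
  by rewrite /k /hardy_weight -/L !(powRD_gt0 _ _ x0); ring.
move: sum; case: (\int[mu]_(x in _) _) => [r| |]//.
rewrite -EFinD eqe => /eqP h; congr (_%:E).
by rewrite -/L mulrBr -h -(mulrA (A `^ p)%R) addrK.
Qed.

(** The closed forms match through p / (a (p - a)) = 1/(p - a) + 1/a. *)
Lemma hardy_indic :
  hardy_lhs p a l f = (p / a)%:E * hardy_rhs_int p a l f.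
Proof.
rewrite hardy_lhs_indic hardy_rhs_int_indic -EFinM; congr (_%:E).
rewrite (powRD_gt0 p (- a) c0); field.
by rewrite !gt_eqF.
Qed.

(** Sharpness needs a finite positive J to compare constants strictly. Positivity follows from l^-a
    <= c^-a and 1/p < 1/(p - a). *)
Lemma hardy_rhs_int_indic_gt0 : exists2 J : R, (0 < J)%R &
  hardy_rhs_int p a l f = J%:E.
Proof.
eexists; last exact: hardy_rhs_int_indic.
rewrite mulr_gt0 ?powR_gt0// subr_gt0.
apply: (@le_lt_trans _ _ (c `^ (- a) * (c `^ p / p))%R).
  rewrite ler_wpM2r ?divr_ge0 ?powR_ge0 ?(ltW p0)//.
  by rewrite -subr_ge0 (hardy_weight_ge0 (l := l) a0)//; split.
rewrite mulrA -(powRD_gt0 _ _ c0) addrC ltr_pM2l ?powR_gt0//.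
by rewrite ltf_pV2 ?posrE// gtrBl.
Qed.

End indicator.

(** * Both inequalities, the equality case and sharpness *)

Theorem theorem3p2 (R : realType) (p a : R) (l : \bar R) :
  0 < p -> 0 < a -> a < p -> (0 < l)%E ->
  (* (a) *)
  (1 <= p -> forall f : R -> R, admissible l f ->
     ((p / a)%:E * hardy_rhs_int p a l f <= hardy_lhs p a l f)%E)
  /\
  (* (b) *)
  (p <= 1 -> forall f : R -> R, admissible l f ->
     (hardy_lhs p a l f <= (p / a)%:E * hardy_rhs_int p a l f)%E)
  /\
  (* (c) equality for f = A * chi_(0,c) *)
  (forall c A : R, 0 < c -> (c%:E < l)%E -> 0 < A ->
     hardy_lhs p a l (fun x => (A * \1_(`]0, c[ : set R) x)%R)
     = ((p / a)%:E * hardy_rhs_int p a l (fun x => (A * \1_(`]0, c[ : set R) x)%R))%E)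
  /\
  (* (c) sharpness of p/a in (a) *)
  (1 <= p -> forall C : R, p / a < C ->
     exists f : R -> R, admissible l f /\
       (hardy_lhs p a l f < C%:E * hardy_rhs_int p a l f)%E)
  /\
  (* (c) sharpness of p/a in (b) *)
  (p <= 1 -> forall C : R, C < p / a ->
     exists f : R -> R, admissible l f /\
       (C%:E * hardy_rhs_int p a l f < hardy_lhs p a l f)%E).
Proof.
move=> p0 a0 ap l0.
split; first by move=> p1 f; exact: hardy_ge.
split; first by move=> p1 f; exact: hardy_le.
split; first by move=> c A c0 cl A0; exact: hardy_indic.
(* The exhaustion serves only to supply a point c of (0,l) for finite and infinite l alike; the
   extremal function is chi_(0,c), with A = 1. *)
have [t [It _ _]] := Iol_exhaustion l0; have [c0 cl] := It 0%N.
have adm := admissible_indic l (t 0%N) ltr01.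
have [J J0 JE] := hardy_rhs_int_indic_gt0 l0 a0 ap c0 cl ltr01.
(* By the equality case both sides are multiples of the same J > 0, so they compare as C and p/a
   do. *)
by split=> _ C Cp; eexists; (split; first exact: adm);
  rewrite (hardy_indic l0 a0 ap c0 cl ltr01) JE -!EFinM lte_fin (ltr_pM2r J0).
Qed.
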